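(* Let $N \ge 5$ be an integer, $\sigma > -4$, $0 < \mu \le \mu^*$, and assume that $$p > 1 + \frac{\sigma + 4}{\mu_N}.$$ Consider the elliptic problem $$\Delta^2 u - \frac{\mu}{|x|^4} u = |x|^{\sigma} |u|^p + f(x),\quad x \in \Omega_e, \qquad u = \Delta u = 0,\quad x \in \partial B_1. \tag{E}$$ (i) If $$\eta < 4 + \frac{\sigma + 4}{p-1},$$ then problem (E) admits no weak solution for every $f \in \mathcal{F}^+_{\eta}$. (ii) If $$4 + \frac{\sigma + 4}{p-1} \le \eta < \mu_N + 4,$$ then problem (E) admits smooth solutions $u \in C^\infty(\overline{\Omega_e})$ for some $f \in \mathcal{F}^-_{\eta}$.
   Context: $B_1$ is the open unit ball of $\mathbb{R}^N$ and $\Omega_e = \mathbb{R}^N \setminus \overline{B_1}$. The constant $\mu^*$ is $$\mu^* = \left( \frac{N(N-4)}{4} \right)^2,$$ and for $0<\mu\le\mu^*$, $$\mu_N = \frac{N-4}{2} + \sqrt{\left(\frac{N-2}{2}\right)^2 + 1 - \sqrt{(N-2)^2 + \mu}}.$$ For real $\eta<\mu_N+4$, $$\mathcal{F}^+_{\eta} = \{ f \in C(\overline{\Omega_e}) : f > 0,\ f(x) \ge c |x|^{-\eta} \text{ for sufficiently large } |x| \},$$ $$\mathcal{F}^-_{\eta} = \{ f \in C(\overline{\Omega_e}) : f > 0,\ f(x) \le c |x|^{-\eta} \text{ for sufficiently large } |x| \},$$ where $c>0$ is some constant (allowed to depend on $f$). A function $u\in L^p_{\mathrm{loc}}(\overline{\Omega_e})$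 is a weak solution of (E) if $$\int_{\Omega_e} |x|^{\sigma} |u|^p \psi \, dx + \int_{\Omega_e} f\, \psi \, dx = \int_{\Omega_e} u \left( \Delta^2 \psi - \frac{\mu}{|x|^4} \psi \right) dx$$ for all $\psi\in C_c^4(\overline{\Omega_e})$ (compact support in $\overline{\Omega_e}$, which may touch $\partial B_1$) with $\psi\ge 0$ and $\psi=\Delta\psi=0$ on $\partial B_1$. *)

(* Defs.v *)
From HB Require Import structures.
From mathcomp Require Import all_boot all_order all_algebra.
From mathcomp Require Import all_classical all_reals all_analysis.

Set Implicit Arguments.
Unset Strict Implicit.
Unset Printing Implicit Defensive.

Import Order.TTheory GRing.Theory Num.Theory.
Import numFieldNormedType.Exports.

Local Open Scope classical_set_scope.
Local Open Scope ring_scope.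

(* R^n is 'rV[R]_n, with the product topology of MathComp-Analysis.  It gets  *)
(* the sigma-algebra generated by the coordinates, as the library does for    *)
(* n.-tuple T; since R is second countable this is the Borel sigma-algebra.   *)
Section measurable_rV.
Context (R : realType) (n : nat).

Let coord : 'I_n -> 'rV[R]_n -> R := fun i x => x ord0 i.

Let rV_set0 : g_sigma_preimage coord set0.
Proof. exact: sigma_algebra0. Qed.

Let rV_setC A : g_sigma_preimage coord A -> g_sigma_preimage coord (~` A).
Proof. exact: sigma_algebraC. Qed.

Let rV_bigcup (F : (set 'rV[R]_n)^nat) :
  (forall i, g_sigma_preimage coord (F i)) ->
  g_sigma_preimage coord (\bigcup_i (F i)).
Proof. exact: sigma_algebra_bigcup. Qed.

HB.instance Definition _ := @isMeasurable.Build
  (measure_tuple_display default_measure_display)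
  'rV[R]_n (g_sigma_preimage coord) rV_set0 rV_setC rV_bigcup.

Lemma measurable_coord (i : 'I_n) :
  measurable_fun setT (fun x : 'rV[R]_n => x ord0 i).
Proof.
move=> _ Y mY; rewrite setTI; apply: sub_sigma_algebra => /=.
rewrite -bigcup_seq/=; exists i => /=; first by rewrite mem_index_enum.
by exists Y => //; rewrite setTI.
Qed.

Lemma measurable_fun_rV d (T : measurableType d) (f : T -> 'rV[R]_n) :
  (forall i, measurable_fun setT (fun t => f t ord0 i)) ->
  measurable_fun setT f.
Proof.
move=> mf _ A mA; rewrite setTI.
move: A mA; apply: smallest_sub.
  split.
  - by rewrite /= preimage_set0.
  - by move=> A mA /=; rewrite setTD preimage_setC; exact: measurableC.
  - by move=> F mF /=; rewrite preimage_bigcup; exact: bigcup_measurable.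
rewrite -bigcup_seq/=; apply: bigcup_sub => i _ _ [B mB <-] /=.
by rewrite setTI -comp_preimage -[X in measurable X]setTI; exact: mf.
Qed.

End measurable_rV.

Section rV_cons.
Context (R : realType) (n : nat).

Definition rV_cons (p : measurableTypeR R * 'rV[R]_n) : 'rV[R]_n.+1 :=
  \row_i (if unlift ord0 i is Some j then p.2 ord0 j else p.1).

Definition rV_uncons (x : 'rV[R]_n.+1) : measurableTypeR R * 'rV[R]_n :=
  (x ord0 ord0, \row_j x ord0 (lift ord0 j)).

Lemma rV_consK : cancel rV_cons rV_uncons.
Proof.
move=> [a v]; rewrite /rV_uncons /rV_cons /= mxE unlift_none; congr pair.
by apply/rowP => j; rewrite !mxE liftK.
Qed.

Lemma measurable_rV_cons : measurable_fun setT rV_cons.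
Proof.
apply: measurable_fun_rV => i.
case: (unliftP ord0 i) => [j|] ->.
  under eq_fun do rewrite mxE liftK.
  apply: (@measurableT_comp _ _ _ _ _ _ (fun x : 'rV[R]_n => x ord0 j)).
    exact: measurable_coord.
  exact: measurable_snd.
under eq_fun do rewrite mxE unlift_none.
exact: measurable_fst.
Qed.

Lemma measurable_rV_uncons : measurable_fun setT rV_uncons.
Proof.
apply/measurable_fun_pairP; split; first exact: measurable_coord.
apply: measurable_fun_rV => j.
under eq_fun do rewrite /= mxE.
exact: measurable_coord.
Qed.

End rV_cons.

Section lebesgue_rV.
Context (R : realType).

Section step.
Context (n : nat) (m : {sigma_finite_measure set 'rV[R]_n -> \bar R}).

Definition lebesgue_rV_step : set 'rV[R]_n.+1 -> \bar R :=
  pushforward (lebesgue_measure \x m)%E (@rV_cons R n).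

Let step0 : lebesgue_rV_step set0 = 0%E.
Proof. by rewrite /lebesgue_rV_step /pushforward preimage_set0 measure0. Qed.

Let step_ge0 A : (0 <= lebesgue_rV_step A)%E.
Proof. by rewrite /lebesgue_rV_step /pushforward; apply: measure_ge0. Qed.

Let step_additive : semi_sigma_additive lebesgue_rV_step.
Proof.
have mpre A : measurable A -> measurable (@rV_cons R n @^-1` A).
  by move=> mA; rewrite -[X in measurable X]setTI; exact: measurable_rV_cons.
move=> F mF tF mUF; rewrite /lebesgue_rV_step /pushforward preimage_bigcup.
apply: measure_semi_sigma_additive.
- by move=> k; exact: mpre.
- apply/trivIsetP => /= i j _ _ ij; rewrite -preimage_setI.
  by move/trivIsetP : tF => /(_ _ _ _ _ ij) ->//; rewrite preimage_set0.
- by rewrite -preimage_bigcup; exact: mpre.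
Qed.

HB.instance Definition _ := isMeasure.Build _ _ _ lebesgue_rV_step
  step0 step_ge0 step_additive.

Let step_sigma_finite : sigma_finite setT lebesgue_rV_step.
Proof.
have [F [TF ndF Foo]] : exists F : (set (measurableTypeR R))^nat,
    [/\ setT = \bigcup_k F k, nondecreasing_seq F &
        forall k, measurable (F k) /\ (lebesgue_measure (F k) < +oo)%E].
  by apply/sigma_finiteP; exact: sigma_finiteT.
have /sigma_finiteP[G [TG ndG Goo]] := sigma_finiteT m.
exists (fun k => @rV_uncons R n @^-1` (F k `*` G k)).
  apply/esym; rewrite -subTset => x _.
  have [i _ Fi] : (\bigcup_k F k) (rV_uncons x).1 by rewrite -TF.
  have [j _ Gj] : (\bigcup_k G k) (rV_uncons x).2 by rewrite -TG.
  exists (maxn i j) => //; split.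
    by move: Fi; exact/subsetPset/ndF/leq_maxl.
  by move: Gj; exact/subsetPset/ndG/leq_maxr.
move=> k; have [mF Fk] := Foo k; have [mG Gk] := Goo k; split.
  rewrite -[X in measurable X]setTI; apply: measurable_rV_uncons => //.
  exact: measurableX.
rewrite /lebesgue_rV_step /pushforward -comp_preimage.
rewrite (_ : _ \o _ = id) ?preimage_id; last first.
  by apply/funext => p; exact: rV_consK.
by rewrite product_measure1E// lte_mul_pinfty// ge0_fin_numE.
Qed.

HB.instance Definition _ := @Measure_isSigmaFinite.Build _ _ _
  lebesgue_rV_step step_sigma_finite.

End step.

Definition dirac_rV0 : set 'rV[R]_0 -> \bar R := dirac (0 : 'rV[R]_0).

HB.instance Definition _ := Measure.on dirac_rV0.

Let sigma_finite_dirac_rV0 : sigma_finite setT dirac_rV0.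
Proof.
apply: fin_num_fun_sigma_finite => [|A mA]; rewrite /dirac_rV0 diracE//.
exact: ltry.
Qed.

HB.instance Definition _ := @Measure_isSigmaFinite.Build _ _ _
  dirac_rV0 sigma_finite_dirac_rV0.

(* The n-fold product of the Lebesgue measure of R.  Points of R x R^n are    *)
(* identified with points of R^(n+1) by rV_cons.                              *)
Fixpoint lebesgue_rV (n : nat) : {sigma_finite_measure set 'rV[R]_n -> \bar R} :=
  match n with
  | 0 => dirac_rV0
  | n'.+1 => lebesgue_rV_step (lebesgue_rV n')
  end.

End lebesgue_rV.

Section function_spaces.
Context (R : realType) (n : nat).
Implicit Types (Om A : set 'rV[R]_n) (f g : 'rV[R]_n -> R).

(* The norm `|x| of 'rV[R]_n is the sup norm; this is |x| in R^n. *)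
Definition enorm (x : 'rV[R]_n) : R := Num.sqrt (\sum_i x ord0 i ^+ 2).

Definition partial (i : 'I_n) f : 'rV[R]_n -> R :=
  fun x => 'D_(delta_mx ord0 i) f x.

Definition partials (s : seq 'I_n) f : 'rV[R]_n -> R := foldr partial f s.

Definition laplacian f : 'rV[R]_n -> R :=
  fun x => \sum_i partial i (partial i f) x.

Definition frontier A : set 'rV[R]_n := closure A `\` interior A.

Definition C_closure Om f : Prop := {within closure Om, continuous f}.

(* C^k up to the boundary: f is continuous on the closure of Om, and the      *)
(* partial derivatives of order at most k exist in Om and extend continuously *)
(* to the closure.  A function on the closure is a total function here, whose *)
(* values outside the closure play no role.                                   *)
Definition Ck_closure (k : nat) Om f : Prop :=
  [/\ C_closure Om f,
      forall s i x, (size s < k)%N -> Om x ->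
        derivable (partials s f) x (delta_mx ord0 i) &
      forall s, (size s <= k)%N -> exists2 g : 'rV[R]_n -> R,
        C_closure Om g & forall x, Om x -> g x = partials s f x].

Definition smooth_closure Om f : Prop := forall k, Ck_closure k Om f.

(* For f in Ck_closure 2, the boundary values of the Laplacian are those of   *)
(* its continuous extension, that is, its limits from inside Om.              *)
Definition laplacian_vanishes_at Om f (x : 'rV[R]_n) : Prop :=
  laplacian f y @[y --> within Om (nbhs x)] --> (0 : R).

Definition support_in_closure Om f : set 'rV[R]_n :=
  closure (closure Om `&` [set x | f x != 0]).

(* Borel functions represent all classes of Lebesgue measurable functions. *)
Definition Lp_loc_closure (p : R) Om f : Prop :=
  measurable_fun Om f /\
  forall K : set 'rV[R]_n, compact K -> K `<=` closure Om ->
    (lebesgue_rV R n).-integrable (K `&` Om) (fun x => (`|f x| `^ p)%:E).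

End function_spaces.

Section exterior_problem.
Context (R : realType) (N : nat).
Implicit Types (f u psi : 'rV[R]_N -> R) (mu sigma p eta : R).

Definition unit_ball : set 'rV[R]_N := [set x | enorm x < 1].

Definition ext_dom : set 'rV[R]_N := ~` closure unit_ball.

Definition mu_star : R := (N%:R * (N%:R - 4) / 4) ^+ 2.

Definition mu_N mu : R :=
  (N%:R - 4) / 2 +
  Num.sqrt (((N%:R - 2) / 2) ^+ 2 + 1 - Num.sqrt ((N%:R - 2) ^+ 2 + mu)).

Definition F_plus eta f : Prop :=
  [/\ C_closure ext_dom f,
      forall x, closure ext_dom x -> 0 < f x &
      exists c r : R, 0 < c /\
        forall x, closure ext_dom x -> r <= enorm x ->
          c * enorm x `^ (- eta) <= f x].

Definition F_minus eta f : Prop :=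
  [/\ C_closure ext_dom f,
      forall x, closure ext_dom x -> 0 < f x &
      exists c r : R, 0 < c /\
        forall x, closure ext_dom x -> r <= enorm x ->
          f x <= c * enorm x `^ (- eta)].

Definition test_function psi : Prop :=
  [/\ Ck_closure 4 ext_dom psi,
      compact (support_in_closure ext_dom psi),
      forall x, closure ext_dom x -> 0 <= psi x &
      forall x, frontier unit_ball x ->
        psi x = 0 /\ laplacian_vanishes_at ext_dom psi x].

(* For u in L^p_loc, 1 < p and f continuous on the closure, the three         *)
(* integrands are integrable, so that these real-valued integrals are the     *)
(* actual ones.                                                               *)
Definition weak_solution mu sigma p f u : Prop :=
  Lp_loc_closure p ext_dom u /\
  forall psi, test_function psi ->
    \int[lebesgue_rV R N]_(x in ext_dom)
        (enorm x `^ sigma * `|u x| `^ p * psi x)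
    + \int[lebesgue_rV R N]_(x in ext_dom) (f x * psi x)
    = \int[lebesgue_rV R N]_(x in ext_dom)
        (u x * (laplacian (laplacian psi) x - mu / enorm x ^+ 4 * psi x)).

Definition smooth_solution mu sigma p f u : Prop :=
  [/\ smooth_closure ext_dom u,
      forall x, ext_dom x ->
        laplacian (laplacian u) x - mu / enorm x ^+ 4 * u x
        = enorm x `^ sigma * `|u x| `^ p + f x &
      forall x, frontier unit_ball x ->
        u x = 0 /\ laplacian_vanishes_at ext_dom u x].

End exterior_problem.

(* Main.v *)
(* Nonexistence: test the equation with a C^4 bump psi_r supported in the cube
   [r, 2r]^N, which stays away from the boundary.  For m large the bump
   psi_r = Y^m satisfies |L psi_r| <= K r^-4 Y^(m-4), where
   L = Delta^2 - mu |x|^-4, so Young's inequality absorbs u L psi_r into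
   |x|^sigma |u|^p psi_r up to O(r^-(4 + (sigma + 4) / (p - 1))).  The mean of f
   over the cube is therefore at most of that order, whereas f in F_plus eta
   makes it at least of order r^-eta; let r tend to infinity.

   Existence: L |x|^-(s+t) = P(t) |x|^-(s+t+4) with s = (N - 4) / 2 and P a
   quadratic in t^2 with roots t1^2 < t2^2, where mu_N = s + t1, and P < 0 between
   t1 and t2.  Choose t0 > t1 close to t1 and
   u = eps (- |x|^-(s+t0) + alpha |x|^-(s+t1) + beta |x|^-(s+t2)), where alpha and
   beta are determined by u = Delta u = 0 on the unit sphere.  Then
   L u = - eps P(t0) |x|^-(s+t0+4) is positive and decays faster than |x|^-eta,
   while |x|^sigma |u|^p = O(eps^p |x|^(sigma - p mu_N)) is smaller for t0 near t1
   and eps small, because (p - 1) mu_N > sigma + 4; f is the difference. *)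
Require Import Defs.
From mathcomp Require Import all_boot all_order all_algebra.
From mathcomp Require Import all_classical all_reals all_analysis.
From mathcomp Require Import measurable_realfun.
From mathcomp Require Import ring lra.

Set Implicit Arguments.
Unset Strict Implicit.
Unset Printing Implicit Defensive.

Import Order.TTheory GRing.Theory Num.Theory.
Import numFieldNormedType.Exports.

Local Open Scope classical_set_scope.
Local Open Scope ring_scope.

(** * Directional derivatives, and products of one-variable functions of the coordinates *)

Section directional.
Context (R : realType) (n : nat).
Implicit Types (F : 'rV[R]_n -> R) (x v : 'rV[R]_n).

(** The two difference quotients coincide, so every partial derivative below reduces to calculus in
    one variable. *)
Lemma is_derive_line F x v d :
  is_derive (0 : R) 1 (fun t => F (t *: v + x)) d -> is_derive x v F d.
Proof.
have E : (fun h : R => h^-1 *: ((F \o shift x) (h *: v) - F x)) =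
    (fun h : R => h^-1 *: (((fun t => F (t *: v + x)) \o shift 0) (h *: 1)
                         - (fun t => F (t *: v + x)) 0)).
  by apply/funext => h /=; rewrite [h%:A]mulr1 addr0 scale0r add0r.
case=> df <-; split; first by rewrite /derivable E; exact: df.
by rewrite /derive E.
Qed.

Lemma delta_line x (i k : 'I_n) (t : R) :
  (t *: delta_mx ord0 i + x) ord0 k = x ord0 k + t * (k == i)%:R.
Proof. by rewrite !mxE eqxx/= addrC. Qed.

Lemma is_derive_shift (f : R -> R) (a d : R) :
  is_derive a 1 f d -> is_derive (0 : R) 1 (fun t => f (a + t)) d.
Proof.
move=> df; rewrite -[d]mulr1.
apply: (@is_derive1_comp R f (fun t => a + t)); first by rewrite addr0.
rewrite -[X in is_derive _ _ _ X](add0r (1 : R)).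
exact: is_deriveD.
Qed.

Lemma is_derive_partial F x i d :
  is_derive x (delta_mx ord0 i) F d -> partial i F x = d.
Proof. by case. Qed.

Lemma laplacianE F x :
  laplacian F x = \sum_i partials [:: i; i] F x.
Proof. by []. Qed.

Variables (phi : nat -> R -> R) (K : nat).
Hypothesis dphi : forall j t, (j < K)%N -> is_derive t (1 : R) (phi j) (phi j.+1 t).

(** Here [phi j] stands for the j-th derivative of [phi 0], and [c k] counts the differentiations in
    coordinate [k], so that iterated partial derivatives remain products. *)
Definition prod_coord (c : 'I_n -> nat) x : R := \prod_k phi (c k) (x ord0 k).

Lemma is_derive_prod_coord (c : 'I_n -> nat) i x : (c i < K)%N ->
  is_derive x (delta_mx ord0 i) (prod_coord c)
    (prod_coord (fun k => ((k == i) + c k)%N) x).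
Proof.
move=> cK; apply: is_derive_line.
rewrite /prod_coord (bigD1 i)//= eqxx add1n.
under [X in _ * X]eq_bigr => k ki do rewrite (negbTE ki) add0n.
rewrite mulrC (_ : (fun t => _) =
    (fun t => (\prod_(k | k != i) phi (c k) (x ord0 k)) *:
              phi (c i) (x ord0 i + t))); last first.
  apply/funext => t; rewrite (bigD1 i)//= delta_line eqxx mulr1 mulrC.
  rewrite /GRing.scale/=; congr (_ * _); apply: eq_bigr => k ki.
  by rewrite delta_line (negbTE ki) mulr0 addr0.
apply: is_deriveZ; apply: is_derive_shift; exact: dphi.
Qed.

Lemma partials_prod_coord s : (size s <= K)%N ->
  partials s (prod_coord (fun=> 0%N)) = prod_coord (fun k => count_mem k s).
Proof.
elim: s => [//|i s IH] /= sK; rewrite IH; last exact: ltnW.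
apply/funext => x.
have cK : (count_mem i s < K)%N by rewrite (leq_ltn_trans _ sK)// count_size.
rewrite (is_derive_partial (@is_derive_prod_coord (fun k => count_mem k s) i x cK)).
by apply: eq_bigr => k _; rewrite eq_sym.
Qed.

Lemma derivable_partials_prod_coord s i x : (size s < K)%N ->
  derivable (partials s (prod_coord (fun=> 0%N))) x (delta_mx ord0 i).
Proof.
move=> sK; rewrite partials_prod_coord; last exact: ltnW.
have cK : (count_mem i s < K)%N by rewrite (leq_ltn_trans _ sK)// count_size.
by have [] := @is_derive_prod_coord (fun k => count_mem k s) i x cK.
Qed.

Lemma continuous_prod_coord (c : 'I_n -> nat) : (forall k, c k < K)%N ->
  continuous (prod_coord c).
Proof.
move=> cK; apply: (continuous_big (@mul_continuous R)) => k _ x.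
apply: (@continuous_comp _ _ _ (fun x : 'rV[R]_n => x ord0 k) (phi (c k))).
  exact: coord_continuous.
apply/differentiable_continuous/derivable1_diffP.
by have [] := dphi (x ord0 k) (cK k).
Qed.

Lemma bilaplacian_prod_coord x : (4 <= K)%N ->
  laplacian (laplacian (prod_coord (fun=> 0%N))) x =
  \sum_i \sum_j prod_coord (fun k => count_mem k [:: i; i; j; j]) x.
Proof.
move=> K4.
(* Additivity of [partial] needs derivable summands, so derivability is checked at both of the outer
   differentiations. *)
have sum_partial i (g : 'I_n -> 'rV[R]_n -> R) :
    (forall j x, derivable (g j) x (delta_mx ord0 i)) ->
    partial i (fun x => \sum_j g j x) = fun x => \sum_j partial i (g j) x.
  move=> dg; apply/funext => y; apply: is_derive_partial.
  rewrite (_ : (fun x => _) = \sum_j g j); last first.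
    by apply/funext => z; rewrite fct_sumE.
  apply: is_derive_sum => j; exact/derivableP.
have lapE : laplacian (prod_coord (fun=> 0%N)) =
    fun x => \sum_j partials [:: j; j] (prod_coord (fun=> 0%N)) x.
  by apply/funext => y; rewrite laplacianE.
rewrite lapE /laplacian; apply: eq_bigr => i _.
rewrite sum_partial; last first.
  move=> j y; apply: (@derivable_partials_prod_coord [:: j; j] i y).
  exact: leq_trans K4.
rewrite (sum_partial i
  (fun j => partials [:: i; j; j] (prod_coord (fun=> 0%N)))); last first.
  move=> j y; apply: (@derivable_partials_prod_coord [:: i; j; j] i y).
  exact: leq_trans K4.
by apply: eq_bigr => j _; rewrite -partials_prod_coord.
Qed.

End directional.

(** * A compactly supported one-variable bump and its derivatives *)

Section bump.
Context (R : realType).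
Implicit Types (q : {poly R}) (t : R).

Lemma is_derive_pospart k (y : R) :
  is_derive y (1 : R) (fun z => Num.max 0 z ^+ k.+2)
    (k.+2%:R * Num.max 0 y ^+ k.+1).
Proof.
have [y0|y0|->] := ltgtP y 0.
- rewrite expr0n/= mulr0.
  apply: (near_eq_is_derive _ (is_derive_cst (0 : R) y 1)).
  near=> z; rewrite /cst max_l ?expr0n//; apply/ltW; near: z.
  exact: lt_nbhsl.
- have D : is_derive y (1 : R) (horner ('X^(k.+2) : {poly R})) (k.+2%:R * y ^+ k.+1).
    have := is_derive_poly ('X^(k.+2) : {poly R}) y.
    by rewrite derivXn hornerMn hornerXn mulr_natl.
  apply: near_eq_is_derive D.
  near=> z; rewrite hornerXn max_r//; apply/ltW; near: z.
  exact: lt_nbhsr.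
(* At the kink the slope function is the next lower power of the positive part, which is continuous
   and vanishes at 0. *)
- apply/is_derive1_caratheodory.
  exists (fun z => Num.max 0 z ^+ k.+1); split.
  + move=> z; rewrite maxxx expr0n subr0 subr0 [in LHS]exprSr.
    by case: (leP 0 z) => // _; rewrite expr0n/= !mul0r.
  + apply: (@continuous_comp _ _ _ (fun z : R => Num.max 0 z) (fun z => z ^+ k.+1)).
      by apply: (@continuous_max _ _ (cst (0 : R)) id); [exact: cst_continuous|].
    exact: exprn_continuous.
  + by rewrite maxxx expr0n/= mulr0.
Unshelve. all: by end_near. Qed.

Definition bump_poly : {poly R} := ('X - 1) * (2%:P - 'X).

Definition bump_base t := Num.max 0 bump_poly.[t].

(** This form is closed under differentiation at the cost of one power of [bump_base]; the
    polynomial [q] records the rest. *)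
Definition bump_term q k t := q.[t] * bump_base t ^+ k.

Lemma bump_polyE t : bump_poly.[t] = (t - 1) * (2 - t).
Proof. by rewrite /bump_poly !hornerE. Qed.

Lemma bump_base_ge0 t : 0 <= bump_base t.
Proof. by rewrite le_max lexx. Qed.

Lemma bump_base_le1 t : bump_base t <= 1.
Proof. by rewrite ge_max ler01/= bump_polyE; have := sqr_ge0 (t - 3 / 2); nra. Qed.

Lemma bump_base_eq0 t : ~~ (1 < t < 2) -> bump_base t = 0.
Proof.
rewrite /bump_base bump_polyE => t12; apply/max_l.
have [t1|t1] := leP t 1; first by nra.
by move: t12; rewrite t1/= -leNgt => t2; nra.
Qed.

Lemma bump_base_ge t : 5 / 4 <= t <= 7 / 4 -> 1 / 8 <= bump_base t.
Proof.
rewrite /bump_base bump_polyE le_max => /andP[t1 t2].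
by apply/orP; right; nra.
Qed.

Lemma is_derive_bump_term q k t :
  is_derive t (1 : R) (bump_term q k.+2)
    (bump_term (q^`() * bump_poly + k.+2%:R *: (q * bump_poly^`())) k.+1 t).
Proof.
rewrite (_ : bump_term _ _ t =
    q.[t] *: (k.+2%:R * bump_base t ^+ k.+1 * bump_poly^`().[t])
    + bump_base t ^+ k.+2 *: q^`().[t]); last first.
  (* One factor [bump_base] may be replaced by [bump_poly]: where they differ, the remaining
     positive power vanishes. *)
  have -> : bump_base t ^+ k.+2 = bump_poly.[t] * bump_base t ^+ k.+1.
    rewrite exprS /bump_base; case: (leP 0 bump_poly.[t]) => // _.
    by rewrite expr0n/= !mulr0.
  rewrite /bump_term !hornerE /GRing.scale/=.
  set a := q.[t]; set b := bump_poly.[t]; set c := _ ^+ k.+1.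
  by set d := (bump_poly^`()).[t]; set e := (q^`()).[t]; ring.
have : is_derive t (1 : R) ((fun z => Num.max 0 z ^+ k.+2) \o horner bump_poly)
    (k.+2%:R * Num.max 0 bump_poly.[t] ^+ k.+1 * bump_poly^`().[t]).
  apply: (@is_derive1_comp _ (fun z => Num.max 0 z ^+ k.+2)).
  exact: is_derive_pospart.
move=> D; exact: (is_deriveM (is_derive_poly q t) D).
Qed.

Variable m : nat.

Fixpoint bump_coef j : {poly R} :=
  if j is j'.+1 then
    (bump_coef j')^`() * bump_poly + (m - j')%:R *: (bump_coef j' * bump_poly^`())
  else 1.

(** For [j < m] this is the j-th derivative of [bump r 0], the m-th power of [bump_base] rescaled to
    the interval from [r] to [2 * r]. *)
Definition bump (r : R) j t := r ^- j * bump_term (bump_coef j) (m - j) (r^-1 * t).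

Lemma bump0 r t : bump r 0 t = bump_base (r^-1 * t) ^+ m.
Proof. by rewrite /bump expr0 invr1 mul1r subn0 /bump_term hornerC mul1r. Qed.

Lemma is_derive_bump r j t : (j.+1 < m)%N ->
  is_derive t (1 : R) (bump r j) (bump r j.+1 t).
Proof.
move=> jm.
have mj : (m - j = (m - j.+2).+2)%N by rewrite -subSn// -subSn// ltnW.
have mj1 : (m - j.+1 = (m - j.+2).+1)%N by rewrite -subSn// subSS.
have D : is_derive t (1 : R) (bump_term (bump_coef j) (m - j) \o ( *%R r^-1))
    (bump_term (bump_coef j.+1) (m - j.+1) (r^-1 * t) * r^-1).
  apply: is_derive1_comp; first by rewrite /= mj mj1; exact: is_derive_bump_term.
  by rewrite -[X in is_derive _ _ _ X]mulr1; exact: is_deriveZ.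
rewrite (_ : bump r j.+1 t = r ^- j *:
  (bump_term (bump_coef j.+1) (m - j.+1) (r^-1 * t) * r^-1)); last first.
  rewrite /bump exprS invfM -[_ *: _]/(_ * _).
  by set T := bump_term _ _ _; set a := _^-1; set b := _^-1; ring.
exact: (is_deriveZ (r ^- j)).
Qed.

(** Powers of [t] are at most powers of 2, so the absolute coefficients bound each polynomial;
    adding the five bounds gives one constant, independent of [r]. *)
Lemma bump_coef_bound : exists2 C : R, 1 <= C &
  forall j t, (j < 5)%N -> 1 < t < 2 -> `|(bump_coef j).[t]| <= C.
Proof.
pose B q : R := \sum_(i < size q) `|q`_i| * 2 ^+ i.
have B0 q : 0 <= B q.
  by apply: sumr_ge0 => i _; rewrite mulr_ge0// exprn_ge0.
exists (1 + \sum_(j < 5) B (bump_coef j)).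
  by rewrite lerDl sumr_ge0.
move=> j t j5 /andP[t1 t2].
apply: (@le_trans _ _ (B (bump_coef j))).
  rewrite horner_coef (le_trans (ler_norm_sum _ _ _))// ler_sum// => i _.
  rewrite normrM ler_wpM2l// normrX lerXn2r ?nnegrE//.
  by rewrite ger0_norm; lra.
rewrite (bigD1 (Ordinal j5))//= addrCA lerDl.
by rewrite addr_ge0// sumr_ge0.
Qed.

(** The j-th derivative keeps the power [m - j] of a base that is at most 1, and [m - j] is at least
    [m - 4]. *)
Lemma bump_bound : (5 <= m)%N -> exists2 C : R, 1 <= C &
  forall (r : R) j t, 0 < r -> (j <= 4)%N ->
    `|bump r j t| <= C * r ^- j * bump_base (r^-1 * t) ^+ (m - 4).
Proof.
move=> m5; have [C C1 CP] := bump_coef_bound; exists C => // r j t r0 j4.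
have rj0 : 0 < r ^- j by rewrite invr_gt0 exprn_gt0.
rewrite /bump normrM gtr0_norm//.
rewrite [C * r ^- j]mulrC -mulrA ler_pM2l//.
set s := r^-1 * t.
(* Outside the support both sides vanish: [5 <= m] keeps the exponents positive, whereas [0 ^+ 0]
   would be 1. *)
have [s12|s12] := boolP (1 < s < 2); last first.
  have mk k : (k <= 4)%N -> (m - k == 0)%N = false.
    by move=> k4; rewrite subn_eq0 leqNgt (leq_ltn_trans k4).
  by rewrite /bump_term (bump_base_eq0 s12) !expr0n !mk//= !mulr0 normr0.
rewrite /bump_term normrM ler_pM//; first exact: CP.
rewrite ger0_norm ?exprn_ge0 ?bump_base_ge0//.
by rewrite ler_wiXn2l ?bump_base_ge0 ?bump_base_le1// leq_sub2l.
Qed.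

End bump.

(** * The Euclidean norm and the geometry of the exterior domain *)

Section enorm_theory.
Context (R : realType) (n : nat).
Implicit Types x : 'rV[R]_n.

Definition sqnorm x : R := \sum_i x ord0 i ^+ 2.

Lemma sqnorm_ge0 x : 0 <= sqnorm x.
Proof. by apply: sumr_ge0 => i _; exact: sqr_ge0. Qed.

Lemma enorm_ge0 x : 0 <= enorm x.
Proof. exact: sqrtr_ge0. Qed.

Lemma sqr_enorm x : enorm x ^+ 2 = sqnorm x.
Proof. by rewrite /enorm sqr_sqrtr// sqnorm_ge0. Qed.

Lemma coord_le_enorm x k : `|x ord0 k| <= enorm x.
Proof.
rewrite -sqrtr_sqr ler_wsqrtr// (bigD1 k)//= lerDl.
by apply: sumr_ge0 => i _; exact: sqr_ge0.
Qed.

Lemma enormZ (t : R) x : enorm (t *: x) = `|t| * enorm x.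
Proof.
rewrite /enorm -[`|t|]sqrtr_sqr -sqrtrM ?sqr_ge0// mulr_sumr.
by congr Num.sqrt; apply: eq_bigr => i _; rewrite mxE exprMn.
Qed.

Lemma continuous_coord k : continuous (fun x => x ord0 k).
Proof. exact: coord_continuous. Qed.

Lemma continuous_sqnorm : continuous sqnorm.
Proof.
apply: (continuous_big (@add_continuous R)) => i _ x.
apply: (@continuous_comp _ _ _ (fun x : 'rV[R]_n => x ord0 i) (fun z => z ^+ 2)).
  exact: continuous_coord.
exact: exprn_continuous.
Qed.

Lemma continuous_enorm : continuous (@enorm R n).
Proof.
move=> x; apply: (@continuous_comp _ _ _ sqnorm Num.sqrt).
  exact: continuous_sqnorm.
exact: sqrt_continuous.
Qed.

Lemma closed_enorm_le (a : R) : closed [set x : 'rV[R]_n | enorm x <= a].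
Proof. exact: (proj1 (continuous_closedP _) continuous_enorm _ (@closed_le R a)). Qed.

Lemma closed_enorm_ge (a : R) : closed [set x : 'rV[R]_n | a <= enorm x].
Proof. exact: (proj1 (continuous_closedP _) continuous_enorm _ (@closed_ge R a)). Qed.

Lemma closure_unit_ballE : closure (@unit_ball R n) = [set x | enorm x <= 1].
Proof.
apply/seteqP; split => x.
  move=> Bx; apply: (closed_enorm_le (a := 1)).
  by apply: closureS Bx => y /ltW.
move=> /= x1 A Ax.
(* A point of the closed ball is approached radially from inside the open ball. *)
have sx : (fun t : R => t *: x) @ 1^'- --> x.
  apply: cvg_at_left_filter; rewrite -[X in _ --> X]scale1r.
  exact: scalel_continuous.
near (1 : R)^'- => t.
exists (t *: x); split; last by near: t; exact: sx.
rewrite /unit_ball/= enormZ.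
have t0 : 0 <= t by near: t; exact: nbhs_left_ge.
have t1 : t < 1 by near: t; exact: nbhs_left_lt.
by rewrite ger0_norm// (le_lt_trans _ t1)// ler_piMr.
Unshelve. all: by end_near. Qed.

Lemma ext_domE : @ext_dom R n = [set x | 1 < enorm x].
Proof.
rewrite /ext_dom closure_unit_ballE; apply/seteqP; split => x /=.
  by move/negP; rewrite -ltNge.
by rewrite ltNge => /negP.
Qed.

Lemma closure_ext_dom x : closure (@ext_dom R n) x -> 1 <= enorm x.
Proof.
move=> Ox; apply: (closed_enorm_ge (a := 1)).
by apply: closureS Ox => y; rewrite ext_domE => /ltW.
Qed.

Lemma frontier_unit_ball x : frontier (@unit_ball R n) x -> enorm x = 1.
Proof.
rewrite /frontier closure_unit_ballE => -[/= x1 nx].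
apply/eqP; rewrite eq_le x1/= leNgt; apply/negP => lx1; apply: nx.
have : open (@unit_ball R n).
  exact: (proj1 (continuousP _) continuous_enorm _ (@open_lt R 1)).
by move/interior_id ->.
Qed.

End enorm_theory.

(** * Cubes: compactness, measurability and norm bounds *)

Section box.
Context (R : realType) (n : nat).
Implicit Types (x : 'rV[R]_n).

Definition box (a b : R) : set 'rV[R]_n :=
  [set x | forall k, x ord0 k \in `[a, b]].

Lemma compact_box (a b : R) : compact (box a b).
Proof.
apply: (@rV_compact R n (fun=> [set` `[a, b]])) => k.
exact: segment_compact.
Qed.

Lemma closed_box (a b : R) : closed (box a b).
Proof.
rewrite (_ : box a b = \bigcap_(k in setT) (fun x => x ord0 k) @^-1` [set` `[a, b]]).
  apply: closed_bigI => k _.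
  apply: (proj1 (continuous_closedP _) (@continuous_coord R n k)).
  exact: interval_closed.
by apply/seteqP; split => [x ab k _|x ab k]; [exact: ab|exact: (ab k)].
Qed.

Lemma measurable_box (a b : R) : measurable (box a b).
Proof.
rewrite (_ : box a b = \bigcap_(k in [set: 'I_n])
    (setT `&` (fun x => x ord0 k) @^-1` [set` `[a, b]])).
  apply: fin_bigcap_measurable; first exact: finite_finset.
  by move=> k _; apply: measurable_coord.
apply/seteqP; split => [x ab k _|x ab k]; first by split=> //; exact: ab.
by have [_] := ab k Logic.I.
Qed.

Hypothesis n_gt0 : (0 < n)%N.

Lemma enorm_box (a b : R) x : 0 < a -> box a b x ->
  a <= enorm x <= n%:R * b.
Proof.
move=> a0 abx; have k0 : 'I_n := Ordinal n_gt0.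
have k1 k : 0 < x ord0 k <= b.
  by have := abx k; rewrite in_itv/= => /andP[ax ->]; rewrite (lt_le_trans a0).
apply/andP; split.
  apply: le_trans (coord_le_enorm x k0).
  have := abx k0; rewrite in_itv/= => /andP[ax _].
  by rewrite (le_trans ax)// ler_norm.
have b0 : 0 <= b by have /andP[/ltW x0] := k1 k0; exact: le_trans.
rewrite -(@ler_pXn2r _ 2)// ?nnegrE ?enorm_ge0 ?mulr_ge0// sqr_enorm.
apply: (@le_trans _ _ (\sum_(i < n) b ^+ 2)).
  apply: ler_sum => i _; have /andP[xi0 xib] := k1 i.
  by rewrite lerXn2r ?nnegrE// ltW.
rewrite sumr_const card_ord -[b ^+ 2 *+ n]mulr_natl exprMn.
rewrite ler_wpM2r ?sqr_ge0//.
by rewrite -natrX ler_nat -mulnn leq_pmulr.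
Qed.

Lemma box_ext_dom (a b : R) : 1 < a -> box a b `<=` @ext_dom R n.
Proof.
move=> a1 x abx; rewrite ext_domE /=.
have /andP[+ _] := enorm_box (lt_trans ltr01 a1) abx.
exact: lt_le_trans.
Qed.

End box.

(** * The bump on a cube as an admissible test function *)

Section test_function.
Context (R : realType) (n m : nat).
Hypotheses (n_gt0 : (0 < n)%N) (m_gt5 : (5 < m)%N).
Variable r : R.
Hypothesis r_gt1 : 1 < r.
Implicit Types x : 'rV[R]_n.

Let r_gt0 : 0 < r. Proof. exact: lt_trans r_gt1. Qed.

Let dbump j t : (j < 5)%N -> is_derive t (1 : R) (bump m r j) (bump m r j.+1 t).
Proof. by move=> j5; apply: is_derive_bump; exact: leq_ltn_trans m_gt5. Qed.

Definition box_bump : 'rV[R]_n -> R := prod_coord (bump m r) (fun=> 0%N).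

(** This is the function Y of the overview; [box_bump] is its m-th power. *)
Definition box_weight x : R := \prod_k bump_base (r^-1 * x ord0 k).

Lemma box_weight_ge0 x : 0 <= box_weight x.
Proof. by apply: prodr_ge0 => k _; exact: bump_base_ge0. Qed.

Lemma box_weight_le1 x : box_weight x <= 1.
Proof.
apply: prodr_ile1 => k _.
by rewrite bump_base_ge0 bump_base_le1.
Qed.

Lemma box_bumpE x : box_bump x = box_weight x ^+ m.
Proof.
by rewrite /box_weight -prodrXl; apply: eq_bigr => k _; exact: bump0.
Qed.

Lemma box_weight_eq0 x : ~ box r (2 * r) x -> box_weight x = 0.
Proof.
move=> rx; have [k kr] : exists k, ~ (x ord0 k \in `[r, 2 * r]).
  exact/existsNP.
rewrite /box_weight (bigD1 k)//= bump_base_eq0 ?mul0r//.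
apply: contra_notN kr => /andP[k1 k2]; rewrite in_itv/=.
rewrite -(ler_pM2l (_ : 0 < r^-1)) ?invr_gt0//.
rewrite -[X in _ && X](ler_pM2l (_ : 0 < r^-1)) ?invr_gt0//.
by rewrite mulVf ?gt_eqF// mulrCA mulVf ?gt_eqF// mulr1 !ltW.
Qed.

Lemma continuous_partials_box_bump s : (size s <= 4)%N ->
  continuous (partials s box_bump).
Proof.
move=> s4; rewrite (partials_prod_coord dbump) ?(leq_trans s4)//.
apply: (continuous_prod_coord dbump) => k.
by rewrite ltnS (leq_trans _ s4)// count_size.
Qed.

Lemma bilaplacian_box_bump x :
  laplacian (laplacian box_bump) x =
  \sum_i \sum_j prod_coord (bump m r) (fun k => count_mem k [:: i; i; j; j]) x.
Proof. exact: (bilaplacian_prod_coord dbump). Qed.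

Lemma measurable_prod_bump (c : 'I_n -> nat) : (forall k, c k < 5)%N ->
  measurable_fun setT (prod_coord (bump m r) c : 'rV[R]_n -> R).
Proof.
move=> c5; apply: measurable_prod => k _.
apply: (@measurableT_comp _ _ _ _ _ _ (bump m r (c k))); last exact: measurable_coord.
apply: continuous_measurable_fun => t.
apply/differentiable_continuous/derivable1_diffP.
by have [] := dbump t (c5 k).
Qed.

Lemma measurable_box_bump : measurable_fun setT box_bump.
Proof. exact: measurable_prod_bump. Qed.

Lemma measurable_bilaplacian_box_bump :
  measurable_fun setT (laplacian (laplacian box_bump)).
Proof.
rewrite (_ : laplacian _ = fun x => \sum_i \sum_j
    prod_coord (bump m r) (fun k => count_mem k [:: i; i; j; j]) x).
  apply: measurable_sum => i; apply: measurable_sum => j.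
  by apply: measurable_prod_bump => k; rewrite ltnS count_size.
by apply/funext => x; exact: bilaplacian_box_bump.
Qed.

Lemma test_function_box_bump : test_function box_bump.
Proof.
have box_pos x : box_bump x != 0 -> box r (2 * r) x.
  apply: contra_neqP => /box_weight_eq0; rewrite box_bumpE => ->.
  by rewrite expr0n gtn_eqF// (leq_trans _ m_gt5).
split.
- split.
  + by apply: continuous_subspaceT; exact: (@continuous_partials_box_bump [::]).
  + move=> s i x s4 _; apply: (derivable_partials_prod_coord dbump).
    exact: ltnW.
  + move=> s s4; exists (partials s box_bump) => //.
    by apply: continuous_subspaceT; exact: continuous_partials_box_bump.
- apply: (subclosed_compact _ (@compact_box R n r (2 * r))).
    exact: closed_closure.
  rewrite ((closure_id _).1 (@closed_box R n r (2 * r))).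
  by apply: closureS => x [_ /=]; exact: box_pos.
- by move=> x _; rewrite box_bumpE exprn_ge0// box_weight_ge0.
- move=> x /frontier_unit_ball x1.
  (* On the unit sphere each coordinate is at most 1, hence below [r], where the support of every
     factor begins. *)
  have base0 k : bump_base (r^-1 * x ord0 k) = 0.
    apply: bump_base_eq0; apply/negP => /andP[+ _]; apply/negP; rewrite -leNgt.
    rewrite mulrC ler_pdivrMr// mul1r (le_trans (ler_norm _))//.
    by rewrite (le_trans (coord_le_enorm _ _))// x1 ltW.
  have k0 : 'I_n := Ordinal n_gt0.
  have prod0 c : (forall k, c k < 5)%N -> prod_coord (bump m r) c x = 0.
    move=> c5; rewrite /prod_coord (bigD1 k0)//= /bump /bump_term base0 expr0n.
    by rewrite subn_eq0 leqNgt (leq_trans (c5 k0) (ltnW m_gt5))/= !mulr0 mul0r.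
  split; first exact: prod0.
  have lapE : laplacian box_bump = fun y => \sum_j partials [:: j; j] box_bump y.
    by apply/funext => y; rewrite laplacianE.
  (* By continuity on the whole space, the limit of the Laplacian from inside the domain is its
     value at the boundary point. *)
  have lapC : continuous (laplacian box_bump).
    rewrite lapE; apply: (continuous_big (@add_continuous R)) => j _.
    exact: continuous_partials_box_bump.
  apply: cvg_within_filter.
  suff L0 : laplacian box_bump x = 0 by have := lapC x; rewrite /continuous_at L0.
  rewrite lapE big1// => j _.
  rewrite (partials_prod_coord dbump)// prod0// => k.
  by rewrite (leq_ltn_trans (count_size _ _)).
Qed.

End test_function.

(** Each term of the bilaplacian is a product of one-variable derivatives whose orders add up to 4,
    whence [r ^- 4], and each factor retains the power [m - 4] of its base. *)
Lemma bilaplacian_box_bump_le (R : realType) (n m : nat) : (5 < m)%N ->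
  exists2 K : R, 0 <= K & forall (r : R) (x : 'rV[R]_n), 0 < r ->
    `|laplacian (laplacian (@box_bump R n m r)) x| <=
    K * r ^- 4 * box_weight r x ^+ (m - 4).
Proof.
move=> m5; have [C C1 CP] := @bump_bound R m (ltnW m5).
have C0 : 0 <= C by rewrite (le_trans ler01).
exists (\sum_(i < n) \sum_(j < n) C ^+ n).
  by apply: sumr_ge0 => i _; apply: sumr_ge0 => j _; rewrite exprn_ge0.
move=> r x r0; rewrite bilaplacian_box_bump//.
rewrite !mulr_suml (le_trans (ler_norm_sum _ _ _))// ler_sum// => i _.
rewrite (le_trans (ler_norm_sum _ _ _))// ler_sum// => j _.
rewrite /prod_coord normr_prod.
set c := fun k => count_mem k [:: i; i; j; j].
apply: (@le_trans _ _ (\prod_(k < n)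
    (C * r ^- c k * bump_base (r^-1 * x ord0 k) ^+ (m - 4)))).
  apply: ler_prod => k _; apply/andP; split; first exact: normr_ge0.
  by apply: CP => //; exact: (count_size _ [:: i; i; j; j]).
rewrite !big_split/= prodrXl prodr_const card_ord -/(box_weight r x).
rewrite ler_wpM2r ?exprn_ge0 ?box_weight_ge0// ler_wpM2l ?exprn_ge0//.
have sum_count (s : seq 'I_n) : (\sum_(k < n) count_mem k s = size s)%N.
  elim: s => [|a s IH] /=; first by rewrite big1.
  rewrite big_split/= IH (bigD1 a)//= eqxx big1// => k ka.
  by rewrite eq_sym (negbTE ka).
by rewrite prodfV prodrXr sum_count.
Qed.

(** * Comparison of integrals and the volume of a cube *)

Section integral_bounds.
Local Open Scope ereal_scope.

(* [ge0_le_integral] without its measurability hypotheses: the integral of a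
   nonnegative function is a supremum over simple functions below it. *)
Lemma ge0_le_integralS d (T : measurableType d) (R : realType)
    (mu : {measure set T -> \bar R}) (A B : set T) (f g : T -> \bar R) :
  A `<=` B -> (forall x, A x -> 0 <= f x) -> (forall x, B x -> 0 <= g x) ->
  (forall x, A x -> f x <= g x) ->
  \int[mu]_(x in A) f x <= \int[mu]_(x in B) g x.
Proof.
move=> AB f0 g0 fg; rewrite !ge0_integralE//.
apply: ereal_sup_le => _ [h hf <-]; exists h => // x; apply: le_trans (hf x) _.
rewrite /patch; case: ifPn => [/set_mem Ax|_]; last by case: ifPn => // /set_mem/g0.
by rewrite mem_set ?fg//; exact: AB.
Qed.

(** Under [rV_cons] a cube is an interval times a cube of one dimension less; in dimension 0 the
    Dirac mass gives the empty product 1. *)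
Lemma lebesgue_rV_box (R : realType) (n : nat) (a b : R) : (a <= b)%R ->
  lebesgue_rV R n (@box R n a b) = ((b - a) ^+ n)%:E.
Proof.
move=> ab; elim: n => [|n IH].
  rewrite /= /dirac_rV0 diracE expr0 mem_set//.
  by move=> [].
have -> : lebesgue_rV R n.+1 (@box R n.+1 a b) =
    (lebesgue_measure \x lebesgue_rV R n)%E (`[a, b]%classic `*` @box R n a b).
  rewrite /= /lebesgue_rV_step /pushforward; congr (_ _).
  apply/seteqP; split => [[t v] /= tv|[t v] [/= ta vb] k].
    split => [|k] /=.
      by have := tv ord0; rewrite /rV_cons mxE unlift_none.
    by have := tv (lift ord0 k); rewrite /rV_cons mxE liftK.
  rewrite /rV_cons mxE; case: unliftP => [j|] _ /=; last exact: ta.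
  exact: vb.
rewrite product_measure1E//; last exact: measurable_box.
rewrite IH exprS EFinM; congr (_ * _)%E.
have := lebesgue_measure_itv `[a, b]; rewrite /= lte_fin => ->.
have [ab'|ba] := ltP a b; first by rewrite -EFinB.
have -> : a = b by apply/eqP; rewrite eq_le ab ba.
by rewrite subrr.
Qed.

End integral_bounds.

(** * Comparison of real powers and absorption by Young's inequality *)

Section powR_bounds.
Context (R : realType).

(** Powers are monotone in a direction fixed by the sign of [e], which gives the constant a^e or 1.
    This trades |x| for [r] on a cube. *)
Lemma powR_comparable (a e : R) : 1 <= a -> exists2 C : R, 0 < C &
  forall r t : R, 0 < r -> r <= t <= a * r -> t `^ e <= C * r `^ e.
Proof.
move=> a1; have a0 : 0 < a by rewrite (lt_le_trans ltr01).
have [e0|e0] := leP 0 e.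
  exists (a `^ e); first exact: powR_gt0.
  move=> r t r0 /andP[rt tr]; rewrite -powRM ?(ltW a0) ?(ltW r0)//.
  have t0 : 0 < t by exact: lt_le_trans rt.
  by apply: ge0_ler_powR => //; rewrite nnegrE ltW// mulr_gt0.
exists 1 => // r t r0 /andP[rt _]; rewrite mul1r.
have t0 : 0 < t by exact: lt_le_trans rt.
rewrite -[e]opprK powRN [leRHS]powRN lef_pV2 ?posrE ?powR_gt0//.
by rewrite ge0_ler_powR ?nnegrE ?(ltW r0) ?(ltW t0)// oppr_ge0 ltW.
Qed.

(* Either [A] is so large that the second term dominates the first, or the
   first term is bounded; [B] is the threshold where both terms agree. *)
Lemma young_threshold (p kappa s A Y : R) (m k : nat) :
  1 < p -> 0 <= kappa -> 0 < s -> 0 <= A -> 0 <= Y <= 1 -> (k < m)%N ->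
  k%:R / (p - 1) <= (m - k)%:R ->
  kappa * A * Y ^+ (m - k) - s * A `^ p * Y ^+ m
    <= kappa * (kappa / s) `^ (p - 1)^-1.
Proof.
move=> p1 kappa0 s0 A0 /andP[Y0 Y1] km kp.
have p10 : 0 < p - 1 by rewrite subr_gt0.
have rhs0 : 0 <= kappa * (kappa / s) `^ (p - 1)^-1 by rewrite mulr_ge0// powR_ge0.
(* [B] divides by a power of [Y], so [Y = 0] is set apart; there both terms vanish because
   [k < m]. *)
have [->|Yn0] := eqVneq Y 0.
  by rewrite !expr0n !gtn_eqF ?subn_gt0 ?(leq_ltn_trans _ km)//= !mulr0 subr0.
have {Y0 Yn0}Y0 : 0 < Y by rewrite lt_neqAle eq_sym Yn0.
have ks0 : 0 <= kappa / s by rewrite divr_ge0// ltW.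
pose B := (kappa / s / Y ^+ k) `^ (p - 1)^-1.
have [AB|BA] := leP A B.
  apply: (@le_trans _ _ (kappa * A * Y ^+ (m - k))).
    by rewrite gerBl mulr_ge0 ?exprn_ge0 ?mulr_ge0 ?powR_ge0// ltW.
  rewrite -mulrA ler_wpM2l//.
  apply: (@le_trans _ _ (B * Y ^+ (m - k))).
    by rewrite ler_wpM2r// exprn_ge0// ltW.
  (* The negative power of [Y] inside [B] has exponent [k / (p - 1)], which [Y ^+ (m - k)]
     compensates by hypothesis. *)
  rewrite /B powRM ?invr_ge0 ?exprn_ge0 ?(ltW Y0)// -mulrA.
  rewrite ler_piMr ?powR_ge0//.
  rewrite -[Y ^+ k]powR_mulrn ?(ltW Y0)// -powRN -powRrM.
  rewrite -[Y ^+ (m - k)]powR_mulrn ?(ltW Y0)//.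
  rewrite -powRD; last by rewrite (gt_eqF Y0) implybT.
  rewrite -[leRHS](powRr0 Y).
  by rewrite ger_powR ?Y0// mulNr addrC subr_ge0.
(* Above the threshold, raising to the power [p - 1] shows that kappa is at most s A^(p-1) Y^k, so
   the difference is nonpositive. *)
have : B `^ (p - 1) <= A `^ (p - 1).
  by rewrite ge0_ler_powR ?nnegrE ?powR_ge0// ltW.
rewrite /B -powRrM mulVf ?gt_eqF// powRr1; last first.
  by rewrite divr_ge0// exprn_ge0// ltW.
rewrite ler_pdivrMr ?exprn_gt0// ler_pdivrMr// => kA.
apply: le_trans rhs0; rewrite subr_le0 -(mulr_powRB1 A0) ?(lt_trans ltr01)//.
rewrite -{2}(subnK (ltnW km)) exprD.
have -> : s * (A * A `^ (p - 1)) * (Y ^+ (m - k) * Y ^+ k) =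
   (A `^ (p - 1) * Y ^+ k * s) * A * Y ^+ (m - k) by ring.
by rewrite !ler_wpM2r// ?exprn_ge0// ltW.
Qed.

End powR_bounds.

(** * Nonexistence of weak solutions under slow decay of the source *)

Section nonexistence.
Context (R : realType) (n : nat).
Hypothesis n_gt0 : (0 < n)%N.
Variables (mu sigma p eta : R).
Hypotheses (mu_ge0 : 0 <= mu) (p_gt1 : 1 < p).
Implicit Types (f u : 'rV[R]_n -> R) (x : 'rV[R]_n).

Let leb := lebesgue_rV R n.

Lemma measurable_enorm : measurable_fun setT (@enorm R n).
Proof.
apply: measurableT_comp; last first.
  apply: measurable_sum => i; apply: measurable_funX; exact: measurable_coord.
apply: continuous_measurable_fun; exact: sqrt_continuous.
Qed.

Lemma measurable_ext_dom : measurable (@ext_dom R n).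
Proof.
rewrite ext_domE -[X in measurable X]setTI.
have := measurable_enorm measurableT (measurable_itv `]1, +oo[).
by congr (measurable _); apply/seteqP; split => x /=;
  rewrite in_itv/= andbT.
Qed.

Lemma Rintegral_ext_dom_box (r : R) (g : 'rV[R]_n -> R) : 1 < r ->
  (forall x, ~ box r (2 * r) x -> g x = 0) ->
  \int[leb]_(x in @ext_dom R n) g x = \int[leb]_(x in box r (2 * r)) g x.
Proof.
move=> r1 g0.
rewrite -[in RHS](setIidr (@box_ext_dom R n n_gt0 r (2 * r) r1)) Rintegral_mkcondr.
apply: eq_Rintegral => x _; rewrite /patch; case: ifPn => // xb.
by rewrite g0// => bx; rewrite mem_set in xb.
Qed.

Lemma leb_box (a b : R) : a <= b ->
  (leb : {measure set 'rV[R]_n -> \bar R}) (box a b) = ((b - a) ^+ n)%:E.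
Proof. exact: lebesgue_rV_box. Qed.

Lemma box_integrable_cst (r c : R) : 0 < r ->
  leb.-integrable (box r (2 * r)) (fun=> c%:E).
Proof.
move=> r0; apply/integrableP; split => //.
rewrite integral_cst; last exact: measurable_box.
rewrite leb_box; last by rewrite ler_pMl// ler1n.
by rewrite -EFinM ltry.
Qed.

(** The equation turns the integral of [f * psi] into that of [g3 - g1], which [young_threshold]
    bounds pointwise; [r ^+ n] is the volume of the cube. The constant [M] precedes [f], [u] and
    [r]. *)
Lemma weak_solution_box_bound (m : nat) : (5 < m)%N ->
  4 / (p - 1) <= (m - 4)%:R ->
  exists M : R, forall (f u : 'rV[R]_n -> R), weak_solution mu sigma p f u ->
  forall r : R, 1 < r ->
  \int[leb]_(x in box r (2 * r)) (f x * box_bump m r x)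
   <= M * r `^ (- (4 + (sigma + 4) / (p - 1))) * r ^+ n.
Proof.
move=> m5 mp; have [K K0 HK] := @bilaplacian_box_bump_le R n m m5.
have n2 : 1 <= n%:R * 2 :> R.
  by have n1 : 1 <= n%:R :> R by [rewrite ler1n]; lra.
(* The exponent is [- sigma] because the absorption divides by the weight |x|^sigma. *)
have [C C0 HC] := powR_comparable (- sigma) n2.
(* [K] accounts for the bilaplacian and [mu] for the potential; both come with [r ^- 4]. *)
pose kappa0 := K + mu; pose q := (p - 1)^-1.
have kappa00 : 0 <= kappa0 by rewrite addr_ge0.
have p10 : 0 < p - 1 by rewrite subr_gt0.
have q0 : 0 < q by rewrite invr_gt0.
exists (kappa0 * (kappa0 * C) `^ q) => f u [[mu_ Lpu] weak] r r1.
have r0 : 0 < r by exact: lt_trans r1.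
have r2 : r <= 2 * r by rewrite ler_peMl ?ler1n// ltW.
pose psi := @box_bump R n m r; pose Y := @box_weight R n r.
pose D := @box R n r (2 * r).
have mD : measurable D by exact: measurable_box.
have DO : D `<=` @ext_dom R n by exact: box_ext_dom.
have Dnorm x : D x -> r <= enorm x <= n%:R * 2 * r.
  by move=> /(enorm_box n_gt0 r0); rewrite mulrA.
pose Lpsi x := laplacian (laplacian psi) x - mu / enorm x ^+ 4 * psi x.
pose kappa := kappa0 * r ^- 4.
have kappa_ge0 : 0 <= kappa by rewrite mulr_ge0// invr_ge0 exprn_ge0// ltW.
have Y01 x : 0 <= Y x <= 1 by rewrite box_weight_ge0 box_weight_le1.
have psiE x : psi x = Y x ^+ m by exact: box_bumpE.
have psi_le1 x : 0 <= psi x <= 1.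
  have /andP[Y0 Y1] := Y01 x.
  by rewrite psiE exprn_ge0//= exprn_ile1.
have Lpsi_le x : D x -> `|Lpsi x| <= kappa * Y x ^+ (m - 4).
  move=> Dx; have /andP[rx _] := Dnorm _ Dx; have /andP[Y0 Y1] := Y01 x.
  rewrite /Lpsi (le_trans (ler_normB _ _))//.
  rewrite /kappa /kappa0 mulrDl mulrDl lerD//; first exact: HK.
  rewrite psiE normrM ger0_norm; last by rewrite divr_ge0// exprn_ge0// enorm_ge0.
  rewrite [X in _ * X]ger0_norm ?exprn_ge0// ler_pM//.
  - by rewrite divr_ge0// exprn_ge0// enorm_ge0.
  - by rewrite exprn_ge0.
  - rewrite ler_wpM2l// lef_pV2 ?posrE ?exprn_gt0//; last exact: lt_le_trans rx.
    by rewrite lerXn2r// nnegrE ?enorm_ge0// ltW.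
  - by rewrite ler_wiXn2l// leq_subr.
(* The bound [HK] itself forces the bilaplacian to vanish wherever [Y] does. *)
have Lpsi0 x : ~ D x -> Lpsi x = 0.
  move=> nDx; have Y0 : Y x = 0 by exact: box_weight_eq0.
  have m0 : (m == 0)%N = false by rewrite gtn_eqF// (leq_trans _ m5).
  rewrite /Lpsi psiE Y0 expr0n m0 mulr0 subr0.
  have := HK r x r0; rewrite -/(Y x) Y0 expr0n subn_eq0 leqNgt (ltnW m5)/= mulr0.
  by rewrite normr_le0 => /eqP.
have psi0 x : ~ D x -> psi x = 0.
  move=> nDx; have Y0 : Y x = 0 by exact: box_weight_eq0.
  by rewrite psiE Y0 expr0n gtn_eqF// (leq_trans _ m5).
have mu' : measurable_fun D u.
  by apply: measurable_funS mu_ => //; exact: measurable_ext_dom.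
have menorm : measurable_fun D (@enorm R n).
  by apply: measurable_funS measurable_enorm.
have mpsi : measurable_fun D psi.
  by apply: (measurable_funS measurableT) => //; exact: measurable_box_bump.
have mLpsi : measurable_fun D Lpsi.
  apply: measurable_funB.
    apply: (measurable_funS measurableT) => //.
    exact: measurable_bilaplacian_box_bump.
  apply: measurable_funM => //; apply: measurable_funM => //.
  rewrite (_ : (fun x => _) = fun x => enorm x `^ (- 4%:R)).
    exact: (measurableT_comp (measurable_powR _)).
  by apply/funext => x; rewrite powR_invn// enorm_ge0.
have int_up : leb.-integrable D (fun x => (`|u x| `^ p)%:E).
  have := Lpu D (@compact_box R n r (2 * r)).
  by rewrite setIidl//; apply => x /DO; exact: subset_closure.
pose g1 x := enorm x `^ sigma * `|u x| `^ p * psi x.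
pose g3 x := u x * Lpsi x.
have weakD : \int[leb]_(x in D) g1 x + \int[leb]_(x in D) (f x * psi x) =
    \int[leb]_(x in D) g3 x.
  have := weak _ (test_function_box_bump n_gt0 m5 r1).
  rewrite !(@Rintegral_ext_dom_box r)//.
  - by move=> x nD; rewrite -/psi -/(Lpsi x) Lpsi0// mulr0.
  - by move=> x nD; rewrite -/psi psi0// mulr0.
  - by move=> x nD; rewrite -/psi psi0// mulr0.
have mup : measurable_fun D (fun x => `|u x| `^ p).
  apply: (measurableT_comp (measurable_powR _)).
  exact: measurableT_comp.
have [C2 C20 HC2] := powR_comparable sigma n2.
have int1 : leb.-integrable D (EFin \o g1).
  apply: (@le_integrable _ _ _ _ _ mD _
      (fun x => (C2 * r `^ sigma)%:E * (`|u x| `^ p)%:E)%E).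
  - apply/measurable_EFinP; apply: measurable_funM => //.
    apply: measurable_funM => //.
    exact: (measurableT_comp (measurable_powR _)).
  - move=> x Dx /=; rewrite lee_fin /g1 !normrM.
    have /andP[psi_ge0 psi1] := psi_le1 x.
    rewrite [`|psi x|]ger0_norm// -[leRHS]mulr1 ler_pM// ?mulr_ge0//.
    rewrite ler_wpM2r// -normrM !ger0_norm ?mulr_ge0 ?powR_ge0// ?(ltW C20)//.
    exact: HC2 (Dnorm _ Dx).
  - exact: integrableZl.
(* Since [1 < p], |u| is at most 1 + |u|^p, which is integrable on the cube. Integrability of [g1]
   and [g3] allows the integral of the difference to be split. *)
have int3 : leb.-integrable D (EFin \o g3).
  apply: (@le_integrable _ _ _ _ _ mD _
      (fun x => kappa%:E + kappa%:E * (`|u x| `^ p)%:E)%E).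
  - by apply/measurable_EFinP; exact: measurable_funM.
  - move=> x Dx /=; rewrite lee_fin /g3 normrM.
    have /andP[Y0 Y1] := Y01 x.
    rewrite [leRHS]ger0_norm; last by rewrite addr_ge0// mulr_ge0// powR_ge0.
    rewrite mulrC -[X in X + _]mulr1 -mulrDr ler_pM//.
      by rewrite (le_trans (Lpsi_le _ Dx))// ler_piMr// exprn_ile1.
    have [u1|u1] := leP `|u x| 1; first by rewrite (le_trans u1)// lerDl powR_ge0.
    by rewrite (le_trans (le1r_powR (ltW u1) (ltW p_gt1)))// lerDr.
  - by apply: integrableD => //; [exact: box_integrable_cst|exact: integrableZl].
have g31 x : D x -> g3 x - g1 x <=
    kappa0 * (kappa0 * C) `^ q * r `^ (- (4 + (sigma + 4) / (p - 1))).
  move=> Dx; have rx := Dnorm _ Dx; have /andP[Y0 Y1] := Y01 x.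
  have x0 : 0 < enorm x by have /andP[+ _] := rx; exact: lt_le_trans.
  apply: (@le_trans _ _ (kappa * `|u x| * Y x ^+ (m - 4)
      - enorm x `^ sigma * `|u x| `^ p * Y x ^+ m)).
    rewrite /g1 psiE lerD2r (le_trans (ler_norm _))// /g3 normrM mulrC mulrAC.
    by rewrite ler_wpM2r// Lpsi_le.
  apply: le_trans (young_threshold p_gt1 kappa_ge0 _ _ (Y01 x) _ mp) _ => //.
    exact: powR_gt0.
    by rewrite (leq_trans _ m5).
  (* Here kappa / |x|^sigma is at most kappa0 C r^-(4+sigma); with the outer factor [kappa] the
     total power of [r] is -4 - (4+sigma) q. *)
  apply: (@le_trans _ _ (kappa * (kappa0 * C * r `^ (- (4 + sigma))) `^ q)).
    rewrite ler_wpM2l// ge0_ler_powR ?nnegrE ?(ltW q0)//.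
    - by rewrite divr_ge0// powR_ge0.
    - by rewrite !mulr_ge0 ?powR_ge0// ltW.
    rewrite /kappa -powRN -mulrA -[leRHS]mulrA ler_wpM2l//.
    have -> : r `^ (- (4 + sigma)) = r ^- 4 * r `^ (- sigma).
      rewrite opprD powRD; last by rewrite (gt_eqF r0) implybT.
      by rewrite -[4]/(4%:R) powR_invn// ltW.
    by rewrite mulrCA ler_wpM2l ?HC// invr_ge0 exprn_ge0// ltW.
  rewrite powRM ?powR_ge0//; last by rewrite mulr_ge0// ltW.
  rewrite /kappa -powRrM -[r ^- 4]powR_invn ?(ltW r0)//.
  have -> : - (4 + (sigma + 4) / (p - 1)) = - 4%:R + (- (4 + sigma) * q).
    by rewrite opprD mulNr /q [sigma + 4]addrC.
  rewrite powRD; last by rewrite (gt_eqF r0) implybT.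
  set a := r `^ _; set b := r `^ _; set c := _ `^ q.
  by rewrite le_eqVlt; apply/orP; left; apply/eqP; ring.
have -> : \int[leb]_(x in D) (f x * psi x) = \int[leb]_(x in D) (g3 x - g1 x).
  by rewrite RintegralB// -weakD addrC addKr.
apply: (@le_trans _ _ (\int[leb]_(x in D)
    (kappa0 * (kappa0 * C) `^ q * r `^ (- (4 + (sigma + 4) / (p - 1)))))).
  apply: le_Rintegral => //; last exact: box_integrable_cst.
  exact: (integrableB mD int3 int1).
rewrite Rintegral_cst// leb_box//=.
by rewrite (_ : 2 * r - r = r)//; ring.
Qed.

(** On the middle cube, with coordinates between [5 / 4 * r] and [7 / 4 * r], the bump stays above a
    constant independent of [r], and the integrand is nonnegative elsewhere. *)
Lemma box_integral_ge (m : nat) (f : 'rV[R]_n -> R) : (5 < m)%N ->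
  F_plus eta f -> exists2 c : R, 0 < c & exists r0 : R, forall r, 1 < r -> r0 <= r ->
  c * r `^ (- eta) * r ^+ n <= \int[leb]_(x in box r (2 * r)) (f x * box_bump m r x).
Proof.
move=> m5 [cf f0 [c [r0 [c0 fc]]]].
have n2 : 1 <= n%:R * 2 :> R.
  by have n1 : 1 <= n%:R :> R by [rewrite ler1n]; lra.
(* An upper bound for |x|^eta is a lower bound for |x|^-eta. *)
have [C C0 HC] := powR_comparable eta n2.
(* Each of the [n] one-variable bases is at least 1/8 on the middle cube. *)
pose w : R := ((1 / 8) ^+ n) ^+ m.
have w0 : 0 < w by rewrite !exprn_gt0// divr_gt0.
(* The last factor is the volume of the middle cube, of side [r / 2], relative to [r ^+ n]. *)
exists (c / C * w * (1 / 2) ^+ n).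
  by rewrite !mulr_gt0 ?invr_gt0// exprn_gt0// divr_gt0.
exists r0 => r r1 rr0; have rgt0 : 0 < r by exact: lt_trans r1.
pose D := @box R n r (2 * r); pose D' := @box R n (5 / 4 * r) (7 / 4 * r).
have D'D : D' `<=` D.
  move=> x Dx k; have := Dx k; rewrite !in_itv/= => /andP[x1 x2].
  by apply/andP; split; lra.
have mD : measurable D by exact: measurable_box.
have mD' : measurable D' by exact: measurable_box.
have Dclos x : D x -> closure (@ext_dom R n) x.
  by move=> Dx; apply: subset_closure; exact: box_ext_dom Dx.
have Dnorm x : D x -> r <= enorm x <= n%:R * 2 * r.
  by move=> /(enorm_box n_gt0 rgt0); rewrite mulrA.
have [M fM] : exists M, forall x, D x -> f x <= M.
  have D0 : D !=set0.
    by exists (const_mx r) => k; rewrite in_itv/= mxE lexx/= ler_peMl ?ler1n// ltW.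
  have fD : {within D, continuous f} by apply: continuous_subspaceW cf => x; exact: Dclos.
  have [z _ fz] := EVT_max_rV D0 (@compact_box R n r (2 * r)) fD.
  by exists (f z) => x Dx; rewrite fz// inE.
have bump_le x : 0 <= box_bump m r x <= 1.
  rewrite box_bumpE exprn_ge0 ?box_weight_ge0//=.
  by rewrite exprn_ile1// ?box_weight_ge0 ?box_weight_le1.
pose h := c / C * w * r `^ (- eta).
have h0 : 0 <= h by rewrite !mulr_ge0 ?powR_ge0 ?invr_ge0// ltW.
have hf x : D' x -> h <= f x * box_bump m r x.
  move=> D'x; have Dx := D'D _ D'x; have /andP[rx xr] := Dnorm _ Dx.
  have x0 : 0 < enorm x by exact: lt_le_trans rx.
  rewrite /h -mulrA [w * _]mulrC mulrA ler_pM//.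
  - by rewrite mulr_ge0 ?powR_ge0// divr_ge0// ltW.
  - exact: ltW.
  - apply: le_trans (fc x (Dclos _ Dx) (le_trans rr0 rx)).
    rewrite -mulrA ler_wpM2l ?(ltW c0)// !powRN -invfM lef_pV2 ?posrE ?powR_gt0//.
      by apply: HC; rewrite ?rx.
    by rewrite mulr_gt0// powR_gt0.
  - rewrite box_bumpE /w lerXn2r ?nnegrE ?exprn_ge0 ?divr_ge0 ?box_weight_ge0//.
    rewrite -[X in _ ^+ X]card_ord -prodr_const ler_prod// => k _.
    rewrite divr_ge0//= bump_base_ge//.
    have := D'x k; rewrite in_itv/= => /andP[x1 x2].
    by rewrite ![r^-1 * _]mulrC ler_pdivlMr// x1 ler_pdivrMr.
have fpsi0 x : D x -> 0 <= f x * box_bump m r x.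
  move=> Dx; have /andP[b0 _] := bump_le x.
  by rewrite mulr_ge0// ltW// f0//; exact: Dclos.
have r2 : r <= 2 * r by rewrite ler_peMl ?ler1n// ltW.
(* Finiteness matters: the real integral is [fine] of the extended one, and [fine] sends an infinite
   value to 0. *)
have up : (\int[leb]_(x in D) (f x * box_bump m r x)%:E <= (M * r ^+ n)%:E)%E.
  apply: (@le_trans _ _ (\int[leb]_(x in D) M%:E)%E).
    apply: ge0_le_integralS => //.
    - by move=> x Dx; rewrite lee_fin (le_trans _ (fM x Dx))// ltW// f0//; exact: Dclos.
    - move=> x Dx; rewrite lee_fin (le_trans _ (fM x Dx))// ler_piMr//.
        by rewrite ltW// f0//; exact: Dclos.
      by have /andP[] := bump_le x.
  rewrite integral_cst// leb_box// -EFinM (_ : 2 * r - r = r)//; ring.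
have low : ((h * (1 / 2 * r) ^+ n)%:E <= \int[leb]_(x in D) (f x * box_bump m r x)%:E)%E.
  apply: (@le_trans _ _ (\int[leb]_(x in D') h%:E)%E).
    rewrite integral_cst// leb_box; last by lra.
    by rewrite -EFinM (_ : 7 / 4 * r - 5 / 4 * r = 1 / 2 * r)//; field.
  by apply: ge0_le_integralS => // x Dx; rewrite lee_fin// ?fpsi0// hf.
rewrite /Rintegral -lee_fin fineK; last first.
  rewrite ge0_fin_numE; first exact: le_lt_trans up (ltry _).
  by apply: integral_ge0 => x Dx; rewrite lee_fin fpsi0.
apply: le_trans low; rewrite lee_fin /h [(1 / 2 * r) ^+ n]exprMn -!mulrA.
by rewrite [r `^ _ * ((1 * _) ^+ n * _)]mulrCA.
Qed.

Lemma no_weak_solution (f : 'rV[R]_n -> R) :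
  eta < 4 + (sigma + 4) / (p - 1) -> F_plus eta f ->
  ~ exists u, weak_solution mu sigma p f u.
Proof.
move=> etap Ff [u wu].
have p10 : 0 < p - 1 by rewrite subr_gt0.
have [m m5 mp] : exists2 m, (5 < m)%N & 4 / (p - 1) <= (m - 4)%:R.
  exists (Num.bound (4 / (p - 1)) + 6)%N; first by rewrite addnS ltnS addnS ltnS leq_addl.
  rewrite -addnBA// natrD (le_trans (ltW (archi_boundP _))) ?divr_ge0 ?lerDl// ltW//.
have [M HM] := weak_solution_box_bound m5 mp.
have [c c0 [r0 Hr]] := box_integral_ge m5 Ff.
pose d := 4 + (sigma + 4) / (p - 1) - eta.
have d0 : 0 < d by rewrite subr_gt0.
(* The bounds give c r^d <= M, which fails once r^d >= t. *)
pose t : R := `|M| / c + 1.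
have t0 : 0 < t by rewrite ltr_wpDl// divr_ge0// ltW.
pose r : R := Num.max 2 (Num.max r0 (t `^ d^-1)).
have r1 : 1 < r by rewrite lt_max ltr1n.
have rgt0 : 0 < r by exact: lt_trans r1.
have rr0 : r0 <= r by rewrite !le_max lexx orbT.
have rt : t <= r `^ d.
  rewrite -[leLHS](powRr1 (ltW t0)) -(mulVf (lt0r_neq0 d0)) powRrM.
  by rewrite ge0_ler_powR ?nnegrE ?powR_ge0 ?(ltW d0) ?(ltW rgt0)// !le_max lexx !orbT.
have := le_trans (Hr r r1 rr0) (HM f u wu r r1).
rewrite ler_pM2r ?exprn_gt0//.
have -> : r `^ (- eta) = r `^ d * r `^ (- (4 + (sigma + 4) / (p - 1))).
  rewrite -powRD; last by rewrite (gt_eqF rgt0) implybT.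
  by congr (_ `^ _); rewrite /d; ring.
rewrite mulrA ler_pM2r ?powR_gt0//.
apply/negP; rewrite -ltNge (le_lt_trans (ler_norm _))//.
rewrite -ltr_pdivrMl// mulrC (lt_le_trans _ rt)// /t ltrDl//.
Qed.

End nonexistence.

(** * Radial powers away from the origin: smoothness and Laplacians *)

Section smooth_away.
Context (R : realType) (n : nat).
Implicit Types (F G : 'rV[R]_n -> R) (x : 'rV[R]_n) (s : seq 'I_n).

(** This is |x|^(2b). Without the square root, its restriction to a coordinate line is a real power
    of a quadratic polynomial. *)
Definition rad (b : R) x : R := sqnorm x `^ b.

(** A syntactic class closed under partial derivatives off the origin, so that derivatives of all
    orders are handled by induction. *)
Inductive smooth_away : ('rV[R]_n -> R) -> Prop :=
| smooth_cst c : smooth_away (fun=> c)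
| smooth_coord i : smooth_away (fun x => x ord0 i)
| smooth_rad b : smooth_away (rad b)
| smoothD F G : smooth_away F -> smooth_away G -> smooth_away (fun x => F x + G x)
| smoothM F G : smooth_away F -> smooth_away G -> smooth_away (fun x => F x * G x).

(** Derivative formulas for [rad] are established only off the origin; as that set is open, this
    equality passes to derivatives. *)
Definition eq_away F G := forall x, 0 < sqnorm x -> F x = G x.

Lemma near_sqnorm_gt0 x : 0 < sqnorm x -> \forall y \near x, 0 < sqnorm y.
Proof.
have : open (@sqnorm R n @^-1` [set t | 0 < t]).
  exact: (proj1 (continuousP _) (@continuous_sqnorm R n) _ (@open_gt R 0)).
by rewrite openE => /(_ x)/[apply].
Qed.

Lemma eq_away_near F G x : eq_away F G -> 0 < sqnorm x -> \near x, F x = G x.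
Proof. by move=> FG /near_sqnorm_gt0; apply: filterS => y; exact: FG. Qed.

Lemma eq_away_partial F G i : eq_away F G -> eq_away (partial i F) (partial i G).
Proof. by move=> FG x x0; apply: near_eq_derive; exact: eq_away_near. Qed.

Lemma eq_away_laplacian F G : eq_away F G -> eq_away (laplacian F) (laplacian G).
Proof.
move=> FG x x0; apply: eq_bigr => i _.
by apply: eq_away_partial => //; exact: eq_away_partial.
Qed.

Lemma is_derive_coord x (i k : 'I_n) :
  is_derive x (delta_mx ord0 i) (fun x : 'rV[R]_n => x ord0 k) (k == i)%:R.
Proof.
apply: is_derive_line.
rewrite (_ : (fun t => _) = horner ((x ord0 k)%:P + (k == i)%:R *: 'X)); last first.
  by apply/funext => t; rewrite delta_line !hornerE mulrC.
have := is_derive_poly ((x ord0 k)%:P + (k == i)%:R *: 'X) 0.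
by rewrite derivD derivC derivZ derivX add0r !hornerE.
Qed.

Lemma sqnorm_line x (i : 'I_n) (t : R) :
  sqnorm (t *: delta_mx ord0 i + x) = sqnorm x + (2 * x ord0 i) * t + t ^+ 2.
Proof.
rewrite /sqnorm (bigD1 i)//= [in RHS](bigD1 i)//= delta_line eqxx mulr1.
under eq_bigr => k ki do rewrite delta_line (negbTE ki) mulr0 addr0.
by set a := \sum_(_ | _) _; ring.
Qed.

Lemma is_derive_rad b x i : 0 < sqnorm x ->
  is_derive x (delta_mx ord0 i) (rad b) (2 * b * x ord0 i * rad (b - 1) x).
Proof.
move=> x0; apply: is_derive_line.
pose P : {poly R} := (sqnorm x)%:P + (2 * x ord0 i) *: 'X + 'X^2.
have PE t : P.[t] = sqnorm (t *: delta_mx ord0 i + x).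
  by rewrite sqnorm_line /P !hornerE.
rewrite (_ : (fun t => _) = (fun z : R => z `^ b) \o horner P); last first.
  by apply/funext => t /=; rewrite PE.
have P0 : P.[0] = sqnorm x by rewrite PE scale0r add0r.
rewrite (_ : 2 * b * _ * _ = (b * P.[0] `^ (b - 1)) * P^`().[0]); last first.
  have -> : P^`().[0] = 2 * x ord0 i.
    rewrite /P !derivD derivC derivZ derivX derivXn.
    by rewrite expr1 add0r hornerD hornerZ hornerC mulr1 hornerMn hornerX mul0rn addr0.
  by rewrite P0 /rad; ring.
apply: is_derive1_comp; apply: is_derive1_powR.
by rewrite P0.
Qed.

Lemma smooth_away_derive F i : smooth_away F -> exists2 G, smooth_away G &
  forall x, 0 < sqnorm x -> is_derive x (delta_mx ord0 i) F (G x).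
Proof.
elim => [c|k|b|F1 F2 sF1 [G1 sG1 H1] sF2 [G2 sG2 H2]
  |F1 F2 sF1 [G1 sG1 H1] sF2 [G2 sG2 H2]].
- by exists (fun=> 0); [exact: smooth_cst|move=> x _; exact: is_derive_cst].
- exists (fun=> (k == i)%:R); first exact: smooth_cst.
  by move=> x _; exact: is_derive_coord.
- exists (fun x => (2 * b * x ord0 i) * rad (b - 1) x).
    apply: smoothM; last exact: smooth_rad.
    by apply: smoothM; [exact: smooth_cst|exact: smooth_coord].
  by move=> x x0; exact: is_derive_rad.
- exists (fun x => G1 x + G2 x); first exact: smoothD.
  by move=> x x0; apply: is_deriveD; [exact: H1|exact: H2].
- exists (fun x => F1 x * G2 x + F2 x * G1 x); first by apply: smoothD; exact: smoothM.
  move=> x x0; exact: (is_deriveM (H1 x x0) (H2 x x0)).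
Qed.

Lemma smooth_away_continuous F x : smooth_away F -> 0 < sqnorm x ->
  {for x, continuous F}.
Proof.
move=> sF x0; elim: sF => [c|k|b|F1 F2 _ H1 _ H2|F1 F2 _ H1 _ H2].
- exact: cst_continuous.
- exact: continuous_coord.
- apply: (@continuous_comp _ _ _ (@sqnorm R n) (fun z : R => z `^ b)).
    exact: continuous_sqnorm.
  apply/differentiable_continuous/derivable1_diffP.
  by have [] := @is_derive1_powR R b (sqnorm x) x0.
- exact: continuousD.
- exact: continuousM.
Qed.

Lemma smooth_away_partials F s : smooth_away F ->
  exists2 G, smooth_away G & eq_away (partials s F) G.
Proof.
move=> sF; elim: s => [|i s [G sG FG]]; first by exists F.
have [G' sG' GG'] := smooth_away_derive i sG; exists G' => // x x0.
by rewrite /= (eq_away_partial i FG x0); have [] := GG' x x0.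
Qed.

(** The closure of the domain avoids the origin, so the derivatives extend to it by their own
    formulas. *)
Lemma smooth_away_closure F : smooth_away F -> smooth_closure (@ext_dom R n) F.
Proof.
move=> sF k.
have clos x : closure (@ext_dom R n) x -> 0 < sqnorm x.
  by move/closure_ext_dom => x1; rewrite -sqr_enorm exprn_gt0// (lt_le_trans ltr01).
have cont G : smooth_away G -> C_closure (@ext_dom R n) G.
  move=> sG; apply/subspace_continuousP => x /clos x0.
  by apply: cvg_within_filter; exact: smooth_away_continuous.
split; first exact: cont.
- move=> s i x _ Ox; have [G sG FG] := smooth_away_partials s sF.
  have x0 : 0 < sqnorm x by apply: clos; exact: subset_closure.
  have [G' _ GG'] := smooth_away_derive i sG.
  apply: (@near_eq_derivable _ _ _ G); last by have [] := GG' x x0.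
  by apply: eq_away_near => // y y0; rewrite FG.
- move=> s _; have [G sG FG] := smooth_away_partials s sF.
  exists G; first exact: cont.
  by move=> x Ox; rewrite FG//; apply: clos; exact: subset_closure.
Qed.

Definition radsum k (c b : 'I_k -> R) x : R := \sum_j c j * rad (b j) x.

Lemma smooth_radsum k (c b : 'I_k -> R) : smooth_away (radsum c b).
Proof.
have sE (r : seq 'I_k) : smooth_away (fun x => \sum_(j <- r) c j * rad (b j) x).
  elim: r => [|j r IH].
    rewrite (_ : (fun x => _) = fun=> 0); first exact: smooth_cst.
    by apply/funext => x; rewrite big_nil.
  rewrite (_ : (fun x => _) = fun x => c j * rad (b j) x
      + \sum_(l <- r) c l * rad (b l) x).
    apply: smoothD => //; apply: smoothM; first exact: smooth_cst.
    exact: smooth_rad.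
  by apply/funext => x; rewrite big_cons.
exact: sE.
Qed.

(** The terms with squared coordinates add up to [sqnorm x], which raises the exponent by one and
    merges them with the rest. Stability of [radsum] lets the Laplacian be iterated. *)
Lemma laplacian_radsum k (c b : 'I_k -> R) :
  eq_away (laplacian (radsum c b))
    (radsum (fun j => c j * (2 * b j * (n%:R + 2 * b j - 2))) (fun j => b j - 1)).
Proof.
have sumE (h : 'I_k -> 'rV[R]_n -> R) : (fun x => \sum_j h j x) = \sum_j h j.
  by apply/funext => x; rewrite fct_sumE.
pose D1 i x := \sum_j c j * (2 * b j * x ord0 i * rad (b j - 1) x).
have pE i : eq_away (partial i (radsum c b)) (D1 i).
  move=> x x0; apply: is_derive_partial.
  rewrite /radsum sumE; apply: is_derive_sum => j.
  by apply: (is_deriveZ (c j)); exact: is_derive_rad.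
move=> x x0.
have ppE i : partial i (partial i (radsum c b)) x =
    \sum_j c j * (2 * b j) * (rad (b j - 1) x +
      2 * (b j - 1) * (x ord0 i) ^+ 2 * rad (b j - 1 - 1) x).
  rewrite (eq_away_partial i (pE i) x0); apply: is_derive_partial.
  rewrite /D1 sumE; apply: is_derive_sum => j.
  have D := is_deriveZ (c j * (2 * b j))
    (is_deriveM (is_derive_coord x i i) (is_derive_rad (b j - 1) i x0)).
  rewrite (_ : (fun y => _) = (c j * (2 * b j)) \*:
    ((fun y : 'rV[R]_n => y ord0 i) * rad (b j - 1))); last first.
    apply/funext => y; rewrite /= -[RHS]/(_ * (_ * _)). ring.
  apply: (is_derive_eq D); rewrite eqxx /GRing.scale/=; ring.
rewrite /laplacian; under eq_bigr do rewrite ppE.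
rewrite exchange_big/=; apply: eq_bigr => j _.
rewrite -mulr_sumr big_split/= sumr_const card_ord -mulr_suml -mulr_sumr.
rewrite -/(sqnorm x).
have -> : rad (b j - 1) x = sqnorm x * rad (b j - 1 - 1) x.
  rewrite -{1}[sqnorm x]powRr1 ?ltW// /rad -powRD; last first.
    by rewrite (gt_eqF x0) implybT.
  by congr (_ `^ _); ring.
rewrite -[X in X + _]mulr_natl; ring.
Qed.

End smooth_away.

(** * Existence of a smooth solution for a rapidly decaying source *)

Section existence.
Context (R : realType).

(** Zero needs a direct argument; it matters because [u] vanishes on the unit sphere, where [f] must
    still be continuous. *)
Lemma continuous_normr_powR (p : R) : 0 < p -> continuous (fun t : R => `|t| `^ p).
Proof.
move=> p0 t; have [->|t0] := eqVneq t 0.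
  rewrite /continuous_at normr0 powR0 ?gt_eqF//.
  apply/cvgrPdist_lt => e e0; near=> s.
  rewrite sub0r normrN ger0_norm ?powR_ge0//.
  have se : `|s| < e `^ p^-1.
    near: s; apply: (cvgr_norm_lt (0 : R)); first exact: cvg_id.
    by rewrite normr0 powR_gt0.
  have := gt0_ltr_powR p0 _ _ se; rewrite -powRrM mulVf ?gt_eqF// powRr1 ?ltW//.
  by apply; rewrite nnegrE// powR_ge0.
apply: (@continuous_comp _ _ _ (fun t : R => `|t|) (fun z : R => z `^ p)).
  exact: norm_continuous.
apply/differentiable_continuous/derivable1_diffP.
by have [] := @is_derive1_powR R p `|t| ltac:(by rewrite normr_gt0).
Unshelve. all: by end_near. Qed.

Lemma enorm_powR n (x : 'rV[R]_n) (e : R) : enorm x `^ e = rad (e / 2) x.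
Proof. by rewrite /enorm -powR12_sqrt ?sqnorm_ge0// -powRrM mulrC. Qed.

(* With [s = (N - 4) / 2], [|x| `^ - (s + t)] is [rad (- (s + t) / 2)], and the
   operator Delta^2 - mu |x|^-4 maps it to [char_poly N mu t] times
   [|x| `^ - (s + t + 4)]; centering the exponent at [s] makes this even in [t]. *)
Definition char_poly (N mu t : R) : R :=
  (t ^+ 2 - (((N - 2) / 2) ^+ 2 + 1)) ^+ 2 - ((N - 2) ^+ 2 + mu).

Lemma char_polyE (N mu t : R) :
  (2 * (- ((N - 4) / 2 + t) / 2) * (N + 2 * (- ((N - 4) / 2 + t) / 2) - 2)) *
  (2 * (- ((N - 4) / 2 + t) / 2 - 1) * (N + 2 * (- ((N - 4) / 2 + t) / 2 - 1) - 2))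
  - mu = char_poly N mu t.
Proof. by rewrite /char_poly; field. Qed.

(** As a quadratic in t^2, [char_poly] has the roots S - T and S + T. The bound [2 < t2] serves to
    separate the Laplacian factors of the two root powers. *)
Lemma char_poly_roots (N mu : R) : 5 <= N -> 0 < mu ->
  mu <= (N * (N - 4) / 4) ^+ 2 ->
  let t1 := Num.sqrt (((N - 2) / 2) ^+ 2 + 1 - Num.sqrt ((N - 2) ^+ 2 + mu)) in
  exists t2, [/\ t1 < t2, 2 < t2, char_poly N mu t1 = 0, char_poly N mu t2 = 0 &
    forall t, t1 < t < t2 -> char_poly N mu t < 0].
Proof.
move=> N5 mu0 muN /=; set S := (_ ^+ 2 + 1 : R); set T := Num.sqrt ((N - 2) ^+ 2 + mu).
have TE : T ^+ 2 = (N - 2) ^+ 2 + mu by rewrite sqr_sqrtr// addr_ge0 ?sqr_ge0// ltW.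
have T0 : 0 <= T by exact: sqrtr_ge0.
(* The bound on [mu] is S^2 - (N-2)^2, so it says exactly that T^2 <= S^2. *)
have TS : T <= S.
  rewrite -(@ler_pXn2r _ 2)// ?nnegrE//; last by rewrite /S addr_ge0 ?sqr_ge0.
  rewrite TE /S; move: muN; rewrite -(lerD2l ((N - 2) ^+ 2)) => /le_trans; apply.
  by rewrite le_eqVlt; apply/orP; left; apply/eqP; field.
have TN : N - 2 < T.
  rewrite -(@ltr_pXn2r _ 2)// ?nnegrE//; last by lra.
  by rewrite TE ltrDl.
have t1E : Num.sqrt (S - T) ^+ 2 = S - T by rewrite sqr_sqrtr// subr_ge0.
have t2E : Num.sqrt (S + T) ^+ 2 = S + T by rewrite sqr_sqrtr//; lra.
have t12 : Num.sqrt (S - T) < Num.sqrt (S + T).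
  by rewrite ltr_sqrt; lra.
exists (Num.sqrt (S + T)); split => //.
- rewrite -(@ltr_pXn2r _ 2)// ?nnegrE ?sqrtr_ge0// t2E /S.
  by nra.
- by rewrite /char_poly -/S t1E -TE; ring.
- by rewrite /char_poly -/S t2E -TE; ring.
- move=> t /andP[lt1 lt2]; rewrite /char_poly -/S -TE.
  have t0 : 0 <= t by rewrite (le_trans (sqrtr_ge0 _) (ltW lt1)).
  have : S - T < t ^+ 2 by rewrite -t1E ltr_pXn2r// ?nnegrE ?sqrtr_ge0.
  have : t ^+ 2 < S + T by rewrite -t2E ltr_pXn2r// ?nnegrE ?sqrtr_ge0.
  by move: (t ^+ 2) => z; nra.
Qed.

Lemma mu_N_gt0 n (mu : R) : (5 <= n)%N -> 0 < mu_N n mu.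
Proof.
move=> n5; have : 5 <= n%:R :> R by rewrite ler_nat.
by rewrite /mu_N => N5; rewrite ltr_pwDl ?sqrtr_ge0// divr_gt0// subr_gt0; lra.
Qed.

Lemma exists_smooth_solution n (mu sigma p eta : R) : (5 <= n)%N ->
  0 < mu -> mu <= mu_star R n -> 1 < p -> sigma + 4 < (p - 1) * mu_N n mu ->
  eta < mu_N n mu + 4 ->
  exists2 f : 'rV[R]_n -> R, F_minus eta f &
    exists u : 'rV[R]_n -> R, smooth_solution mu sigma p f u.
Proof.
move=> n5 mu0 mus p1 hp heta.
have N5 : 5 <= n%:R :> R by rewrite ler_nat.
have [t2 [t12 t2_gt2 char1 char2 char_neg]] := char_poly_roots N5 mu0 mus.
move: hp heta t12 char1 char_neg; rewrite /mu_N; set N : R := n%:R.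
set s := (N - 4) / 2; set t1 := Num.sqrt _ => hp heta t12 char1 char_neg.
have t1_ge0 : 0 <= t1 by exact: sqrtr_ge0.
(* Below [t2] the polynomial is negative; below the second bound, s + t0 + 4 < p (s + t1) - sigma,
   so the nonlinear term decays faster than L u. *)
pose top : R := Num.min t2 (p * (s + t1) - sigma - 4 - s).
have top1 : t1 < top by rewrite lt_min t12/=; lra.
pose t0 : R := (t1 + top) / 2.
have t01 : t1 < t0 by rewrite /t0; lra.
have t0top : t0 < top by rewrite /t0; lra.
have /andP[t02 t0p] : (t0 < t2) && (t0 < p * (s + t1) - sigma - 4 - s).
  by rewrite -lt_min.
pose kappa := - char_poly N mu t0.
have kappa0 : 0 < kappa by rewrite oppr_gt0 char_neg// t01.
(* The Laplacian of |x|^-(s+t) is [l t] times |x|^-(s+t+2). *)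
pose l t : R := 2 * (- (s + t) / 2) * (N + 2 * (- (s + t) / 2) - 2).
have lE t : l t = (t - 1) ^+ 2 - ((N - 2) / 2) ^+ 2 by rewrite /l /s; field.
(* The difference factors as (t2 - t1) (t1 + t2 - 2), positive by [2 < t2]. *)
have l12 : l t2 - l t1 != 0.
  by rewrite gt_eqF// !lE; nra.
(* The coefficients -1, 1 - beta, beta sum to 0, and [beta] makes their sum weighted by [l] vanish:
   these are the two boundary conditions. *)
pose beta : R := (l t0 - l t1) / (l t2 - l t1).
pose k : seq R := [:: -1; 1 - beta; beta]; pose t_ : seq R := [:: t0; t1; t2].
pose K : R := \sum_(j < 3) `|k`_j|.
have K1 : 1 <= K.
  by rewrite /K !big_ord_recl big_ord0/= normrN1 lerDl !addr_ge0.
have K0 : 0 < K by exact: lt_le_trans K1.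
have p10 : 0 < p - 1 by rewrite subr_gt0.
have p0 : 0 < p by exact: lt_trans p1.
(* Chosen so that (eps K)^p is half of eps kappa. *)
pose eps : R := (kappa / (2 * K `^ p)) `^ (p - 1)^-1.
have Kp0 : 0 < K `^ p by exact: powR_gt0.
have eps0 : 0 < eps by rewrite powR_gt0// divr_gt0// mulr_gt0.
have epsK : (eps * K) `^ p < eps * kappa.
  rewrite powRM ?(ltW eps0) ?(ltW K0)// -(mulr_powRB1 (ltW eps0) p0).
  rewrite -mulrA ltr_pM2l// /eps -powRrM mulVf ?gt_eqF// powRr1; last first.
    by rewrite divr_ge0 ?mulr_ge0 ?(ltW kappa0) ?(ltW Kp0).
  rewrite invfM mulrA mulfVK ?gt_eqF//; lra.
pose c (j : 'I_3) := eps * k`_j; pose b (j : 'I_3) := - (s + t_`_j) / 2.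
pose u : 'rV[R]_n -> R := radsum c b.
pose b0 : R := - (s + t0) / 2; pose b1 : R := - (s + t1) / 2.
have lapu : eq_away (laplacian u) (radsum (fun j => c j * l t_`_j) (fun j => b j - 1)).
  exact: laplacian_radsum.
have bilapu x : 0 < sqnorm x -> laplacian (laplacian u) x - mu / enorm x ^+ 4 * u x =
    eps * kappa * rad (b0 - 1 - 1) x.
  move=> x0; rewrite (eq_away_laplacian lapu x0) laplacian_radsum//.
  have radE (e : R) : rad (e - 1 - 1) x = rad e x / sqnorm x ^+ 2.
    rewrite /rad -addrA powRD; last by rewrite (gt_eqF x0) implybT.
    by rewrite -opprD -[1 + 1]/(2%:R) powR_invn// ltW.
  have -> : enorm x ^+ 4 = sqnorm x ^+ 2 by rewrite -sqr_enorm -exprM.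
  have -> : mu / sqnorm x ^+ 2 * u x =
      \sum_(j < 3) c j * mu * rad (b j - 1 - 1) x.
    rewrite /u /radsum mulr_sumr; apply: eq_bigr => j _; rewrite radE; ring.
  rewrite /radsum -sumrB.
  have charE (j : 'I_3) : l t_`_j * (2 * (b j - 1) * (N + 2 * (b j - 1) - 2)) - mu =
    char_poly N mu t_`_j by exact: char_polyE.
  rewrite (eq_bigr (fun j => c j * char_poly N mu t_`_j * rad (b j - 1 - 1) x)).
    by rewrite !big_ord_recl big_ord0/= char1 char2 /c/= /kappa /b /b0/=; ring.
  by move=> j _; rewrite -charE -mulrBl -[c j * _ * _]mulrA -mulrBr.
pose f x := eps * kappa * rad (b0 - 1 - 1) x - enorm x `^ sigma * `|u x| `^ p.
have clos x : closure (@ext_dom R n) x -> 1 <= sqnorm x.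
  by move/closure_ext_dom => x1; rewrite -sqr_enorm exprn_ege1.
have nonlin x : 1 <= sqnorm x ->
    enorm x `^ sigma * `|u x| `^ p < eps * kappa * rad (b0 - 1 - 1) x.
  move=> x1; have x0 : 0 < sqnorm x by exact: lt_le_trans x1.
  have ux : `|u x| <= eps * K * rad b1 x.
    (* As |x| >= 1 and [t1] is the least of the three exponents, its power dominates all terms. *)
    rewrite /u /radsum (le_trans (ler_norm_sum _ _ _))// /K mulr_sumr mulr_suml.
    apply: ler_sum => j _; rewrite normrM [`|rad _ _|]ger0_norm ?powR_ge0//.
    rewrite /c normrM (gtr0_norm eps0) ler_wpM2l ?mulr_ge0 ?(ltW eps0)//.
    apply: ler_powR => //; rewrite /b /b1.
    have : t1 <= t_`_j.
      by case: j => -[|[|[|//]]] ? /=; [exact: ltW t01|exact: lexx|exact: ltW t12].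
    by move=> ?; lra.
  apply: (@le_lt_trans _ _ (rad (sigma / 2) x * ((eps * K) `^ p * rad (b1 * p) x))).
    rewrite enorm_powR ler_wpM2l ?powR_ge0// /rad powRrM -powRM ?powR_ge0//.
      apply: ge0_ler_powR => //; rewrite ?nnegrE ?(ltW p0)//.
      by rewrite !mulr_ge0 ?powR_ge0// ltW.
    by rewrite mulr_ge0// ltW.
  rewrite mulrCA /rad -powRD; last by rewrite (gt_eqF x0) implybT.
  apply: (@le_lt_trans _ _ ((eps * K) `^ p * rad (b0 - 1 - 1) x)).
    rewrite ler_wpM2l ?powR_ge0//; apply: ler_powR => //.
    by rewrite /b0 /b1; lra.
  by rewrite ltr_pM2r// powR_gt0.
exists f.
  split.
  - apply/subspace_continuousP => x /clos x1; apply: cvg_within_filter.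
    have x0 : 0 < sqnorm x by exact: lt_le_trans x1.
    have radC (e : R) : {for x, continuous (@rad R n e)}.
      by apply: smooth_away_continuous x0; exact: smooth_rad.
    apply: cvgB; first by apply: cvgM; [exact: cvg_cst|exact: radC].
    rewrite enorm_powR; under eq_cvg do rewrite enorm_powR.
    apply: cvgM; first exact: radC.
    apply: (@continuous_comp _ _ _ u (fun z : R => `|z| `^ p)).
      by apply: smooth_away_continuous x0; exact: smooth_radsum.
    exact: continuous_normr_powR.
  - by move=> x /clos x1; rewrite /f subr_gt0 nonlin.
  (* The bound holds on the whole closure, hence radius 0: [f] is at most its first term, and eta <
     s + t1 + 4 < s + t0 + 4. *)
  - exists (eps * kappa), 0; split; first exact: mulr_gt0.
    move=> x /clos x1 _; rewrite /f [enorm x `^ (- eta)]enorm_powR.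
    apply: (@le_trans _ _ (eps * kappa * rad (b0 - 1 - 1) x)).
      by rewrite gerBl mulr_ge0 ?powR_ge0.
    rewrite ler_wpM2l ?mulr_ge0 ?(ltW eps0) ?(ltW kappa0)//.
    by rewrite /rad; apply: ler_powR => //; rewrite /b0; lra.
exists u; split.
- by apply: smooth_away_closure; exact: smooth_radsum.
- move=> x Ox; have x1 : 1 <= sqnorm x by apply: clos; exact: subset_closure.
  by rewrite bilapu ?(lt_le_trans ltr01)// /f [RHS]addrC subrK.
- move=> x /frontier_unit_ball xE.
  have x1 : sqnorm x = 1 by rewrite -sqr_enorm xE expr1n.
  have x0 : 0 < sqnorm x by rewrite x1.
  have rad1 e : rad e x = 1 by rewrite /rad x1 powR1.
  split.
    by rewrite /u /radsum !big_ord_recl big_ord0/= !rad1 /c/=; ring.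
  apply: cvg_within_filter.
  (* Near the sphere the Laplacian of [u] agrees with the continuous [g], which vanishes there by
     the choice of [beta]. *)
  pose g : 'rV[R]_n -> R := radsum (fun j : 'I_3 => c j * l t_`_j) (fun j => b j - 1).
  have gx : g x = 0.
    rewrite /g /radsum !big_ord_recl big_ord0/= !rad1 /c/= /beta.
    by field.
  apply: (@cvg_trans _ (g y @[y --> x])).
    by apply: near_eq_cvg; apply: eq_away_near => // y y0; rewrite lapu.
  have : {for x, continuous g} by apply: smooth_away_continuous x0; exact: smooth_radsum.
  by rewrite /prop_for /continuous_at gx.
Qed.

End existence.
Theorem corollary1p10 (R : realType) (N : nat) (mu sigma p eta : R)
  (hN : (5 <= N)%N) (hsigma : -4 < sigma)
  (hmu0 : 0 < mu) (hmu : mu <= mu_star R N)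
  (hp : 1 + (sigma + 4) / mu_N N mu < p) :
  (eta < 4 + (sigma + 4) / (p - 1) ->
     forall f : 'rV[R]_N -> R, F_plus eta f ->
       ~ exists u : 'rV[R]_N -> R, weak_solution mu sigma p f u) /\
  (4 + (sigma + 4) / (p - 1) <= eta -> eta < mu_N N mu + 4 ->
     exists2 f : 'rV[R]_N -> R, F_minus eta f &
       exists u : 'rV[R]_N -> R, smooth_solution mu sigma p f u).
Proof.
have muN0 : 0 < mu_N N mu by exact: mu_N_gt0.
have sigma4 : 0 < sigma + 4 by lra.
have p1 : 1 < p by apply: lt_trans hp; rewrite ltrDl divr_gt0.
split=> [etap f Ff|_ etamu].
  by apply: (no_weak_solution _ _ _ etap Ff); [exact: leq_trans hN|exact: ltW|].
apply: exists_smooth_solution => //.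
by rewrite -ltr_pdivrMr// ltrBrDl.
Qed.
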